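(* The highest-order facet basis functions on the reference simplex $\widehat T\subset\mathbb R^d$, $d\in\{2,3\}$, defined in the context, are $L^2(\widehat T)$-orthogonal to polynomials up to degree $k-2$: for every facet $F\subset\partial\widehat T$, $$(\phi_*^F,\,q)_{\widehat T}=0\qquad\forall\, q\in[\mathcal P^{k-2}(\widehat T)]^d,$$ where $\phi_*^F=\phi_k^F$ if $d=2$, and $\phi_*^F$ is any element of $\{\phi^F_{ij}: i,j\ge0,\ i+j=k\}$ if $d=3$.
   Context: $k\ge1$ is a fixed integer. $(\cdot,\cdot)_{\widehat T}$ is the $L^2(\widehat T)$ inner product; $\mathcal P^m(\widehat T)$ denotes polynomials of degree $\le m$ ($\{0\}$ if $m<0$). **Reference simplex.** $\widehat T$ is the convex hull of $V_1=(-1,0),V_2=(1,0),V_3=(0,1)$ for $d=2$, and of $V_1=(-1,0,0),V_2=(1,0,0),V_3=(0,1,0),V_4=(0,0,1)$ for $d=3$. $\lambda_i$ are the barycentric coordinates, $\lambda_i(V_j)=\delta_{ij}$. In 2D the curl of a scalar is $\operatorname{curl}g=(\partial_yg,-\partial_xg)$. **Jacobi polynomials.** $p_n^\alpha(x)=\frac{1}{2^nn!(1-x)^\alpha}\frac{d^n}{dx^n}\big((1-x)^\alpha(x^2-1)^n\big)$ for $n\in\mathbb N_0$, $\alpha>-1$; integrated Jacobi polynomials $\hat p_n^\alpha(x)=\int_{-1}^xp_{n-1}^\alpha(\xi)\,d\xi$ for $n\ge1$, $\hat p_0^\alpha=1$. **2D facet functions.** For an edge $F=[f_1,f_2]\in\{[1,2],[2,3],[3,1]\}$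 (from $V_{f_1}$ to $V_{f_2}$) and $1\le i\le k$ $$\phi_i^F=\operatorname{curl}\Big(\hat p^0_{i+1}\big(\tfrac{\lambda_{f_2}-\lambda_{f_1}}{\lambda_{f_2}+\lambda_{f_1}}\big)(\lambda_{f_2}+\lambda_{f_1})^{i+1}\Big).$$ **3D facet functions.** For a face $F=[f_1,f_2,f_3]\in\{[1,2,3],[1,3,4],[1,2,4],[2,3,4]\}$ put $$u_i^F=\hat p_i^0\big(\tfrac{\lambda_{f_2}-\lambda_{f_1}}{\lambda_{f_2}+\lambda_{f_1}}\big)(\lambda_{f_2}+\lambda_{f_1})^i,\quad v_{ij}^F=\hat p_j^{2i-1}\big(\tfrac{\lambda_{f_3}-\lambda_{f_2}-\lambda_{f_1}}{\lambda_{f_3}+\lambda_{f_2}+\lambda_{f_1}}\big)(\lambda_{f_3}+\lambda_{f_2}+\lambda_{f_1})^j,\quad \mathcal N_0^{[f_1,f_2]}=\nabla\lambda_{f_1}\lambda_{f_2}-\lambda_{f_1}\nabla\lambda_{f_2}.$$ Then $\phi_{0l}^F=\nabla\times(\mathcal N_0^{[f_1,f_2]}v_{2l}^F)$ for $1\le l\le k$; $\phi_{ij}^F=\nabla\times\big(\nabla u^F_{i+1}\,v^F_{(i+1)(j+1)}\big)=-\nabla u^F_{i+1}\times\nabla v^F_{(i+1)(j+1)}$ for $i\ge1$, $j\ge0$, $i+j\le k$. (All these expressions are polynomials, extended continuously where denominators vanish.) *)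

(* Defs.v *)
From HB Require Import structures.
From mathcomp Require Import all_boot all_order all_algebra.
From mathcomp Require Import mathcomp_extra boolp classical_sets functions.
From mathcomp Require Import reals ereal interval_inference topology normedtype.
From mathcomp Require Import derive realfun measure lebesgue_measure.
From mathcomp Require Import lebesgue_integral ftc.
From mathcomp Require Import ring lra zify.

Set Implicit Arguments.
Unset Strict Implicit.
Unset Printing Implicit Defensive.

Import Order.TTheory GRing.Theory Num.Theory.
Import numFieldNormedType.Exports.

Local Open Scope classical_set_scope.
Local Open Scope ring_scope.

Section Jacobi.
Variable R : realType.
Implicit Types (p : {poly R}) (a n : nat).

(* The Rodrigues formula, for natural a; the polynomial division by
   (1 - X)^a is exact, see [jacobiE]. *)
Definition jacobi a n : {poly R} :=
  (2 ^+ n * n`!%:R)^-1 *: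
    (((1 - 'X) ^+ a * ('X ^+ 2 - 1) ^+ n)^`(n) %/ (1 - 'X) ^+ a).

(* The coefficient of index 0 is p`_0 / 0 = 0. *)
Definition primitive p : {poly R} :=
  \poly_(m < (size p).+1) (p`_m.-1 / m%:R).

(* For n >= 1, the integral of the Jacobi polynomial of degree n - 1
   from -1, see [intjacobi_integral]. *)
Definition intjacobi a n : {poly R} :=
  if n is n'.+1 then
    primitive (jacobi a n') - (primitive (jacobi a n')).[-1]%:P
  else 1.

(* The polynomial p(x / y) y^n of the variables x, y, extended to y = 0,
   for p of degree at most n, see [homogE]. *)
Definition homog n p (x y : R) : R :=
  \sum_(m < n.+1) p`_m * x ^+ m * y ^+ (n - m).

Lemma dvdp_derivn_exp p q a n : p ^+ (a + n) %| q -> p ^+ a %| q^`(n).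
Proof.
elim: n a => [|n IHn] a; first by rewrite addn0 derivn0.
rewrite addnS -addSn derivnS => /IHn /dvdpP [r ->].
rewrite derivM deriv_exp /= {1}exprSr mulrA.
apply: dvdp_add; first by rewrite mulrAC dvdp_mulIr.
by rewrite -mulrnAl mulrA dvdp_mulIr.
Qed.

Lemma rodrigues_dvdp a n :
  (1 - 'X : {poly R}) ^+ a %| ((1 - 'X) ^+ a * ('X ^+ 2 - 1) ^+ n)^`(n).
Proof.
apply: dvdp_derivn_exp; rewrite exprD dvdp_mul2l; last first.
  by rewrite expf_neq0// -opprB oppr_eq0 polyXsubC_eq0.
by apply: dvdp_exp2r; apply/dvdpP; exists (- ('X + 1)); ring.
Qed.

Lemma jacobiE a n :
  (2 ^+ n * n`!%:R) *: (jacobi a n * (1 - 'X) ^+ a) =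
  ((1 - 'X) ^+ a * ('X ^+ 2 - 1) ^+ n)^`(n).
Proof.
by rewrite -scalerAl scalerA mulfV ?scale1r ?divpK ?rodrigues_dvdp.
Qed.

Lemma size_jacobi a n : (size (jacobi a n) <= n.+1)%N.
Proof.
have s1 : size (1 - 'X : {poly R}) = 2 by rewrite -opprB size_polyN size_XsubC.
have n1 : (1 - 'X : {poly R}) != 0 by rewrite -size_poly_eq0 s1.
apply: leq_trans (size_scale_leq _ _) _.
rewrite size_divp ?expf_neq0// size_exp s1 mul1n.
have : (size ((1 - 'X : {poly R}) ^+ a * ('X ^+ 2 - 1) ^+ n)%R <=
        (a + 2 * n).+1)%N.
  apply: leq_trans (size_polyMleq _ _) _.
  have := size_poly_exp_leq (1 - 'X : {poly R}) a.
  have := size_poly_exp_leq ('X ^+ 2 - 1 : {poly R}) n.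
  rewrite s1 size_XnsubC//= mul1n.
  by move: (size _) (size _) => m1 m2; lia.
move: (_ * _) => q sq.
have : (size q^`(n) <= size q - n)%N.
  elim: n {sq} => [|n IHn]; first by rewrite subn0.
  rewrite derivnS; have [->|q0] := eqVneq (q^`(n)) 0.
    by rewrite deriv0 size_poly0.
  by have := lt_size_deriv q0; lia.
by move/leq_sub2r => /(_ a) /leq_trans; apply; lia.
Qed.

Lemma deriv_primitive p : (primitive p)^`() = p.
Proof.
apply/polyP => m; rewrite coef_deriv coef_poly ltnS.
case: ltnP => [_|/(nth_default 0) ->]; last by rewrite mul0rn.
by rewrite -[LHS]mulr_natr divfK ?pnatr_eq0.
Qed.

Lemma size_intjacobi a n : (size (intjacobi a n) <= n.+1)%N.
Proof.
case: n => [|n] /=; first by rewrite size_poly1.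
apply: leq_trans (size_polyD _ _) _; rewrite geq_max size_polyN.
rewrite (leq_trans (size_poly _ _)) ?ltnS ?size_jacobi//=.
exact: leq_trans (size_polyC_leq1 _) _.
Qed.

Lemma intjacobi_integral a n (x : R) : -1 < x ->
  (\int[lebesgue_measure]_(t in `[(-1)%R, x]) (jacobi a n).[t]%:E =
  (intjacobi a n.+1).[x]%:E)%E.
Proof.
move=> x1; rewrite (@continuous_FTC2 _ _ (horner (primitive (jacobi a n))))//.
- by rewrite /= hornerD hornerN hornerC EFinB.
- by apply: continuous_subspaceT; exact: continuous_horner.
- split; first by move=> y _; exact: derivable_horner.
  + by apply: cvg_at_right_filter; exact: continuous_horner.
  + by apply: cvg_at_left_filter; exact: continuous_horner.
- by move=> y _; rewrite -derivE deriv_primitive.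
Qed.

Lemma homogE n p (x y : R) : (size p <= n.+1)%N -> y != 0 ->
  homog n p x y = p.[x / y] * y ^+ n.
Proof.
move=> sp y0; rewrite (horner_coef_wide _ sp) mulr_suml.
apply: eq_bigr => m _; rewrite expr_div_n -!mulrA; congr (_ * (_ * _)).
have -> : y ^+ n = y ^+ (n - m) * y ^+ m by rewrite -exprD subnK// leq_ord.
by rewrite mulrCA mulVf ?expf_neq0// mulr1.
Qed.

End Jacobi.

Section TwoD.
Variable R : realType.
Implicit Types (g : R * R -> R) (x : R * R).

Definition lebesgue2 := (@lebesgue_measure R \x @lebesgue_measure R)%E.

(* Vertices, barycentric coordinates and facets are indexed from 0. *)
Definition vertex2 (i : 'I_3) : R * R :=
  nth 0 [:: (-1, 0); (1, 0); (0, 1)] i.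

Definition simplex2 : set (R * R) :=
  [set x | exists c : 'I_3 -> R, [/\ forall i, 0 <= c i,
    \sum_i c i = 1 & x = \sum_i c i *: vertex2 i]].

Definition bary2 (i : 'I_3) x : R :=
  nth 0 [:: (1 - x.1 - x.2) / 2; (1 + x.1 - x.2) / 2; x.2] i.

Lemma bary2_vertex i j : bary2 i (vertex2 j) = (i == j)%:R.
Proof.
by case: i j => [[|[|[|//]]] ?] [[|[|[|//]]] ?];
  rewrite /bary2 /vertex2 -val_eqE /=; field.
Qed.

Lemma sum_bary2 x : \sum_i bary2 i x = 1.
Proof. by rewrite !big_ord_recl big_ord0 /bary2 /=; field. Qed.

Lemma bary2E x : x = \sum_i bary2 i x *: vertex2 i.
Proof.
rewrite !big_ord_recl big_ord0 /bary2 /vertex2 /=; case: x => a b /=.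
by apply/pair_equal_spec; split; do 3?rewrite /GRing.scale/=; field.
Qed.

Definition edges : seq ('I_3 * 'I_3) :=
  let o m lt_m3 : 'I_3 := @Ordinal 3 m lt_m3 in
  let v1 := o 0 isT in let v2 := o 1 isT in let v3 := o 2 isT in
  [:: (v1, v2); (v2, v3); (v3, v1)].

Definition d2x g x : R := derive1 (fun t => g (t, x.2)) x.1.
Definition d2y g x : R := derive1 (fun t => g (x.1, t)) x.2.

Definition curl2 g x : R * R := (d2y g x, - d2x g x).

Definition phi2 (f1 f2 : 'I_3) (i : nat) : R * R -> R * R :=
  curl2 (fun x => homog i.+1 (intjacobi R 0 i.+1)
                    (bary2 f2 x - bary2 f1 x) (bary2 f2 x + bary2 f1 x)).

(* Polynomial functions of total degree at most m; only 0 if m < 0. *)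
Definition poly2 (m : int) (q : R * R -> R) : Prop :=
  exists (N : nat) (c : nat -> nat -> R), forall x,
    q x = \sum_(a < N) \sum_(b < N | (a + b)%N%:Z <= m)
            c a b * x.1 ^+ a * x.2 ^+ b.

(* Extended-real valued, so that [inner2 v w = 0] cannot hold by the
   junk value of a divergent real integral. *)
Definition inner2 (v w : R * R -> R * R) : \bar R :=
  (\int[lebesgue2]_(x in simplex2)
     ((v x).1 * (w x).1 + (v x).2 * (w x).2)%:E)%E.

End TwoD.

Section ThreeD.
Variable R : realType.
Implicit Types (g : R * R * R -> R) (x : R * R * R).

Definition lebesgue3 := (@lebesgue2 R \x @lebesgue_measure R)%E.

Definition vertex3 (i : 'I_4) : R * R * R :=
  nth 0 [:: (-1, 0, 0); (1, 0, 0); (0, 1, 0); (0, 0, 1)] i.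

Definition simplex3 : set (R * R * R) :=
  [set x | exists c : 'I_4 -> R, [/\ forall i, 0 <= c i,
    \sum_i c i = 1 & x = \sum_i c i *: vertex3 i]].

Definition bary3 (i : 'I_4) x : R :=
  nth 0 [:: (1 - x.1.1 - x.1.2 - x.2) / 2; (1 + x.1.1 - x.1.2 - x.2) / 2;
            x.1.2; x.2] i.

Lemma bary3_vertex i j : bary3 i (vertex3 j) = (i == j)%:R.
Proof.
by case: i j => [[|[|[|[|//]]]] ?] [[|[|[|[|//]]]] ?];
  rewrite /bary3 /vertex3 -val_eqE /=; field.
Qed.

Lemma sum_bary3 x : \sum_i bary3 i x = 1.
Proof. by rewrite !big_ord_recl big_ord0 /bary3 /=; field. Qed.

Lemma bary3E x : x = \sum_i bary3 i x *: vertex3 i.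
Proof.
rewrite !big_ord_recl big_ord0 /bary3 /vertex3 /=; case: x => [[a b] c] /=.
apply/pair_equal_spec; split; first (apply/pair_equal_spec; split);
  by do 3?rewrite /GRing.scale/=; field.
Qed.

Definition faces : seq ('I_4 * 'I_4 * 'I_4) :=
  let o m lt_m4 : 'I_4 := @Ordinal 4 m lt_m4 in
  let v1 := o 0 isT in let v2 := o 1 isT in
  let v3 := o 2 isT in let v4 := o 3 isT in
  [:: (v1, v2, v3); (v1, v3, v4); (v1, v2, v4); (v2, v3, v4)].

Definition d3x g x : R := derive1 (fun t => g (t, x.1.2, x.2)) x.1.1.
Definition d3y g x : R := derive1 (fun t => g (x.1.1, t, x.2)) x.1.2.
Definition d3z g x : R := derive1 (fun t => g (x.1.1, x.1.2, t)) x.2.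

Definition grad3 g x : R * R * R := (d3x g x, d3y g x, d3z g x).

Definition curl3 (G : R * R * R -> R * R * R) x : R * R * R :=
  let G1 y := (G y).1.1 in let G2 y := (G y).1.2 in let G3 y := (G y).2 in
  (d3y G3 x - d3z G2 x, d3z G1 x - d3x G3 x, d3x G2 x - d3y G1 x).

Definition u3 (f1 f2 : 'I_4) (i : nat) x : R :=
  homog i (intjacobi R 0 i)
    (bary3 f2 x - bary3 f1 x) (bary3 f2 x + bary3 f1 x).

(* Meant for i >= 1, so that the truncated subtraction in 2i - 1 is exact. *)
Definition v3 (f1 f2 f3 : 'I_4) (i j : nat) x : R :=
  homog j (intjacobi R (2 * i - 1)%N j)
    (bary3 f3 x - bary3 f2 x - bary3 f1 x)
    (bary3 f3 x + bary3 f2 x + bary3 f1 x).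

Definition nedelec3 (f1 f2 : 'I_4) x : R * R * R :=
  bary3 f2 x *: grad3 (bary3 f1) x - bary3 f1 x *: grad3 (bary3 f2) x.

(* Meant for j >= 1 if i = 0. *)
Definition phi3 (f1 f2 f3 : 'I_4) (i j : nat) : R * R * R -> R * R * R :=
  if i is 0%N then
    curl3 (fun x => v3 f1 f2 f3 2 j x *: nedelec3 f1 f2 x)
  else
    curl3 (fun x => v3 f1 f2 f3 i.+1 j.+1 x *: grad3 (u3 f1 f2 i.+1) x).

Definition poly3 (m : int) (q : R * R * R -> R) : Prop :=
  exists (N : nat) (d : nat -> nat -> nat -> R), forall x,
    q x = \sum_(a < N) \sum_(b < N) \sum_(c < N | (a + b + c)%N%:Z <= m)
            d a b c * x.1.1 ^+ a * x.1.2 ^+ b * x.2 ^+ c.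

Definition inner3 (v w : R * R * R -> R * R * R) : \bar R :=
  (\int[lebesgue3]_(x in simplex3)
     ((v x).1.1 * (w x).1.1 + (v x).1.2 * (w x).1.2 + (v x).2 * (w x).2)%:E)%E.

End ThreeD.

(* Main.v *)
(* For a polynomial that is homogeneous in the barycentric coordinates, the
   integral over the simplex is, by Dirichlet's formula
   [int s^a t^b r^c = 2 a! b! c! / (a + b + c + 3)!], a fixed multiple of a
   functional that treats the coordinates independently. The formula is
   symmetric in the vertices, so one computation serves all facets. In the
   coordinates [t - s, t + s = y, r - y, r + y] the functional factors, for
   products of the functions [homog n P], into one-dimensional integrals over
   [-1, 1] with Jacobi weights ([duffy2], [duffy3]).
   The gradient of [homog n.+1 p] consists of [homog n] of two polynomials, so
   the facet functions are combinations of such products, and the claim is the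
   orthogonality of (integrated) Jacobi polynomials. By integration by parts,
   [int (1 - x)^a (1 + x)^b p = 0] for [p = p_n^al] when [al <= a] and
   [a + b < al + n], and for [p] the primitive of [p_n^al] when [al <= a + 1]
   and [a + b + 1 < al + n]. *)
From HB Require Import structures.
Require Import Defs.
From mathcomp Require Import all_boot all_order all_algebra.
From mathcomp Require Import mathcomp_extra boolp classical_sets functions.
From mathcomp Require Import reals ereal interval_inference topology normedtype.
From mathcomp Require Import derive realfun measure lebesgue_measure.
From mathcomp Require Import measurable_realfun lebesgue_integral ftc.
From mathcomp Require Import ring lra zify.

Set Implicit Arguments.
Unset Strict Implicit.
Unset Printing Implicit Defensive.

Import Order.TTheory GRing.Theory Num.Theory.
Import numFieldNormedType.Exports.
Local Open Scope classical_set_scope.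
Local Open Scope ring_scope.

(** * Integrals of polynomials and Jacobi orthogonality *)

Section PolynomialIntegral.
Variable R : realType.
Implicit Types (p q g : {poly R}) (u v : R).

Lemma coef_primitive p m : (primitive p)`_m = p`_m.-1 / m%:R.
Proof.
rewrite /primitive coef_poly; case: ltnP => //.
by case: m => // m /(nth_default 0) /= ->; rewrite mul0r.
Qed.

Lemma primitiveD p q : primitive (p + q) = primitive p + primitive q.
Proof. by apply/polyP => m; rewrite coefD !coef_primitive coefD mulrDl. Qed.

Lemma primitiveZ (a : R) p : primitive (a *: p) = a *: primitive p.
Proof. by apply/polyP => m; rewrite coefZ !coef_primitive coefZ mulrA. Qed.

Lemma primitive_deriv p : primitive p^`() = p - (p`_0)%:P.
Proof.
apply/polyP => -[|m]; rewrite coefB coefC coef_primitive /=.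
  by rewrite subrr invr0 mulr0.
by rewrite coef_deriv subr0 -[p`_m.+1 *+ _]mulr_natr mulfK// pnatr_eq0.
Qed.

(** The integral over [u, v], defined by an antiderivative so that one-dimensional computations stay
    algebraic; for [u <= v], [integral_itv_horner] identifies it with the Lebesgue integral. *)
Definition pint u v p : R := (primitive p).[v] - (primitive p).[u].

Lemma pintD u v p q : pint u v (p + q) = pint u v p + pint u v q.
Proof. by rewrite /pint primitiveD !hornerD; ring. Qed.

Lemma pintZ u v (a : R) p : pint u v (a *: p) = a * pint u v p.
Proof. by rewrite /pint primitiveZ !hornerZ; ring. Qed.

Lemma pintB u v p q : pint u v (p - q) = pint u v p - pint u v q.
Proof. by rewrite -scaleN1r pintD pintZ mulN1r. Qed.

Lemma pint_deriv u v p : pint u v p^`() = p.[v] - p.[u].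
Proof. by rewrite /pint primitive_deriv !hornerD !hornerN !hornerC; ring. Qed.

(** Euler's beta integral, by induction on [a]: the product with both exponents raised by one
    vanishes at [u] and [v], so integrating its derivative trades a factor [v - X] for a factor
    [X - u]. *)
Lemma pint_beta u v a b :
  pint u v ((v%:P - 'X) ^+ a * ('X - u%:P) ^+ b) =
  (v - u) ^+ (a + b).+1 * (a`! * b`!)%:R / ((a + b).+1)`!%:R.
Proof.
elim: a b => [|a IHa] b.
  have -> : (v%:P - 'X) ^+ 0 * ('X - u%:P) ^+ b =
      b.+1%:R^-1 *: (('X - u%:P) ^+ b.+1)^`().
    rewrite deriv_exp derivXsubC mul1r -[(_ ^+ b) *+ _]scaler_nat scalerA.
    by rewrite mulVf ?scale1r ?mul1r ?pnatr_eq0.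
  rewrite pintZ pint_deriv !hornerE subrr expr0n /= factS natrM -natr1.
  have fb0 : b`!%:R != 0 :> R by rewrite pnatr_eq0 -lt0n fact_gt0.
  have sb0 : b%:R + 1 != 0 :> R by rewrite natr1 pnatr_eq0.
  by field; rewrite fb0 sb0.
have := pint_deriv u v ((v%:P - 'X) ^+ a.+1 * ('X - u%:P) ^+ b.+1).
have -> : ((v%:P - 'X) ^+ a.+1 * ('X - u%:P) ^+ b.+1)^`() =
    b.+1%:R *: ((v%:P - 'X) ^+ a.+1 * ('X - u%:P) ^+ b) -
    a.+1%:R *: ((v%:P - 'X) ^+ a * ('X - u%:P) ^+ b.+1).
  rewrite derivM !deriv_exp derivXsubC derivB derivC derivX /=.
  by rewrite -!mul_polyC !polyC_natr; ring.
rewrite pintB !pintZ IHa !hornerE !subrr !expr0n /= mul0r mulr0 subrr.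
move/eqP; rewrite subr_eq0 => /eqP e.
apply: (@mulfI _ b.+1%:R); first by rewrite pnatr_eq0.
rewrite e addnS addSn !factS !natrM.
have fb0 : (a + b)`!%:R != 0 :> R by rewrite pnatr_eq0 -lt0n fact_gt0.
have sb0 : 1 + (a + b)%:R != 0 :> R by rewrite nat1r pnatr_eq0.
have ssb0 : 2 + (a + b)%:R != 0 :> R by rewrite -natrD pnatr_eq0.
by field; rewrite fb0 -natrD sb0 ssb0.
Qed.

(** Bernstein polynomials of [-1, 1] without normalising factors; they serve both as a spanning set
    and as Jacobi weights. *)
Definition bernstein a b : {poly R} := (1 - 'X) ^+ a * (1 + 'X) ^+ b.

Lemma bernsteinSl a b : bernstein a.+1 b = (1 - 'X) * bernstein a b.
Proof. by rewrite /bernstein exprS; ring. Qed.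

Lemma bernsteinSr a b : bernstein a b.+1 = (1 + 'X) * bernstein a b.
Proof. by rewrite /bernstein exprS; ring. Qed.

Lemma bernsteinM a b a' b' :
  bernstein a b * bernstein a' b' = bernstein (a + a') (b + b').
Proof. by rewrite /bernstein !exprD; ring. Qed.

Definition pint1 p : R := pint (-1) 1 p.

Lemma pint_bernstein a b :
  pint1 (bernstein a b) = 2 ^+ (a + b).+1 * (a`! * b`!)%:R / ((a + b).+1)`!%:R.
Proof.
have := pint_beta (-1) 1 a b.
by rewrite opprK polyCN polyC1 opprK (addrC 'X).
Qed.

(* Both sides of an identity linear in [p] need only be compared on products
   of powers of [1 - X] and [1 + X]. *)
Lemma bernstein_ind (P : {poly R} -> Prop) n :
  (forall p q, P p -> P q -> P (p + q)) -> (forall a p, P p -> P (a *: p)) ->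
  (forall a b, (a + b)%N = n -> P (bernstein a b)) ->
  forall p, (size p <= n.+1)%N -> P p.
Proof.
move=> PD PZ Pb; have two0 : 2%:R != 0 :> R by rewrite pnatr_eq0.
(* Since [(1 - X) + (1 + X) = 2], a product of lower degree is a combination of two products of
   degree one higher, up to degree exactly [n]. *)
have P1 l : forall a b, (a + b + l)%N = n -> P (bernstein a b).
  elim: l => [|l IHl] a b; first by rewrite addn0; exact: Pb.
  move=> abl; have -> : bernstein a b =
      2^-1 *: (bernstein a.+1 b + bernstein a b.+1).
    apply: (scalerI two0); rewrite scalerA mulfV// scale1r -!mul_polyC.
    by rewrite bernsteinSl bernsteinSr polyC_natr; ring.
  by apply/PZ/PD; apply: IHl; lia.
(* Powers of [X] are removed through [2 X = (1 + X) - (1 - X)]. *)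
have PX m : forall a b, (a + b + m <= n)%N -> P ('X ^+ m * bernstein a b).
  elim: m => [|m IHm] a b abm.
    by rewrite mul1r; apply: (P1 (n - (a + b))%N); lia.
  have -> : 'X ^+ m.+1 * bernstein a b =
      2^-1 *: ('X ^+ m * bernstein a b.+1 +
               (-1) *: ('X ^+ m * bernstein a.+1 b)).
    apply: (scalerI two0); rewrite scalerA mulfV// scale1r -!mul_polyC.
    by rewrite bernsteinSl bernsteinSr exprS polyCN polyC1 polyC_natr; ring.
  by apply/PZ/PD; last apply/PZ; apply: IHm; lia.
move=> p sp; rewrite -[p]coefK poly_def.
apply: (big_ind P) => // [|i _]; last first.
  apply: PZ; have := PX i 0 0; rewrite /bernstein !mulr1; apply.
  by have := ltn_ord i; lia.
by rewrite -(scale0r (bernstein 0 n)); apply: PZ; apply: Pb.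
Qed.

End PolynomialIntegral.

Section Orthogonality.
Variable R : realType.
Implicit Types (p q g : {poly R}).
Notation bernstein := (bernstein R).

Lemma bernstein_split a b :
  bernstein a b.+1 = 2%:R *: bernstein a b - bernstein a.+1 b.
Proof. by rewrite bernsteinSl bernsteinSr -mul_polyC polyC_natr; ring. Qed.

(** Expanding [1 + X = 2 - (1 - X)] leaves only pure powers of [1 - X], with exponents between [a]
    and [a + b]. *)
Lemma pint1_bernstein0 p e n :
  (forall m, (e <= m < n)%N -> pint1 (p * bernstein m 0) = 0) ->
  forall a b, (e <= a)%N -> (a + b < n)%N -> pint1 (p * bernstein a b) = 0.
Proof.
move=> p0 a b; elim: b a => [|b IHb] a ea ab; first by apply: p0; lia.
rewrite bernstein_split mulrBr -scalerAr /pint1 pintB pintZ.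
by rewrite -!/(pint1 _) !IHb ?mulr0 ?subrr//; lia.
Qed.

Lemma pint1_parts p q : p.[1] * q.[1] = 0 -> p.[-1] * q.[-1] = 0 ->
  pint1 (p^`() * q) = - pint1 (p * q^`()).
Proof.
move=> e1 eN1; apply/eqP; rewrite -addr_eq0 -pintD -derivM pint_deriv !hornerM.
by rewrite e1 eN1 subrr.
Qed.

Lemma deriv_bernsteinl m :
  (bernstein m.+1 0)^`() = - m.+1%:R *: bernstein m 0.
Proof.
rewrite /bernstein expr0 !mulr1 deriv_exp derivB derivX derivC -mul_polyC.
by rewrite polyCN polyC_natr /=; ring.
Qed.

(** Both 1 and -1 are roots of [W] of multiplicity at least [n], and each differentiation lowers a
    multiplicity by at most one. *)
Lemma rodrigues_root a n j : (j < n)%N ->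
  let W : {poly R} := (1 - 'X) ^+ a * ('X ^+ 2 - 1) ^+ n in
  W^`(j).[1] = 0 /\ W^`(j).[-1] = 0.
Proof.
move=> jn W.
have aux (r : R) : 'X - r%:P %| 'X ^+ 2 - 1 -> W^`(j).[r] = 0.
  move=> dr; apply/rootP; rewrite -dvdp_XsubCl -['X - _]expr1.
  apply: dvdp_derivn_exp; apply: dvdp_mull; apply: dvdp_trans (dvdp_exp2r _ dr).
  by apply: dvdp_exp2l; lia.
have E : 'X ^+ 2 - 1 = ('X - 1) * ('X + 1) :> {poly R} by ring.
split; apply: aux; rewrite E; first by rewrite polyC1 dvdp_mulr.
by rewrite polyCN polyC1 opprK dvdp_mull.
Qed.

(** Each integration by parts lowers [m] and [j] by one, with boundary terms killed by
    [rodrigues_root]. As [m < j], a derivative is left over when the power of [1 - X] is exhausted,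
    and its integral is again a boundary term. *)
Lemma pint_rodrigues a n m j : (m < j <= n)%N ->
  pint1 (((1 - 'X) ^+ a * ('X ^+ 2 - 1) ^+ n : {poly R})^`(j) *
         bernstein m 0) = 0.
Proof.
elim: m j => [|m IHm] [|j]// /andP[mj jn];
  have [r1 rN1] := @rodrigues_root a n j jn.
  by rewrite /bernstein !mulr1 derivnS /pint1 pint_deriv r1 rN1 subrr.
rewrite derivnS pint1_parts ?r1 ?rN1 ?mul0r// deriv_bernsteinl -scalerAr.
by rewrite /pint1 pintZ -/(pint1 _) IHm ?mulr0 ?oppr0//; lia.
Qed.

Lemma jacobi_orthogonal al n a b : (al <= a)%N -> (a + b < al + n)%N ->
  pint1 (jacobi R al n * bernstein a b) = 0.
Proof.
apply: pint1_bernstein0 => m /andP[am mn].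
have f0 : (2 ^+ n * n`!%:R) != 0 :> R.
  by rewrite mulf_neq0 ?expf_neq0 ?pnatr_eq0// -lt0n fact_gt0.
apply: (mulfI f0); rewrite mulr0 -pintZ.
(* The factor [(1 - X)^al] of the weight turns the Jacobi polynomial into its Rodrigues derivative;
   the remaining exponent [m - al] is below [n]. *)
rewrite -(subnKC am) -(addn0 0%N) -bernsteinM mulrA scalerAl {1}/bernstein mulr1.
by rewrite jacobiE; apply: pint_rodrigues; lia.
Qed.

Lemma deriv_intjacobi al n : (intjacobi R al n.+1)^`() = jacobi R al n.
Proof. by rewrite derivB derivC subr0 deriv_primitive. Qed.

Lemma intjacobiN1 al n : (intjacobi R al n.+1).[-1] = 0.
Proof. by rewrite /= !hornerE subrr. Qed.

(** Integrating [(1 - X)^m] by parts raises the exponent to [m + 1] and reduces the claim to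
    [jacobi_orthogonal]. The boundary term at 1 vanishes by the power, the one at -1 by the
    normalisation of [intjacobi]. *)
Lemma intjacobi_orthogonal al n a b : (al <= a.+1)%N ->
  (a + b + 1 < al + n)%N ->
  pint1 (intjacobi R al n.+1 * bernstein a b) = 0.
Proof.
move=> ala ab; apply: (@pint1_bernstein0 _ al.-1 (al + n).-1); try lia.
move=> m mal.
have m0 : - m.+1%:R != 0 :> R by rewrite oppr_eq0 pnatr_eq0.
apply: (mulfI m0); rewrite mulr0 -pintZ scalerAr -deriv_bernsteinl.
have b1 : (bernstein m.+1 0).[1] = 0.
  by rewrite bernsteinSl hornerM hornerD hornerN hornerX hornerC subrr mul0r.
rewrite -/(pint1 _) -[LHS]opprK -pint1_parts ?b1 ?intjacobiN1 ?mulr0 ?mul0r//.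
by rewrite deriv_intjacobi jacobi_orthogonal ?oppr0//; lia.
Qed.

End Orthogonality.

(** * Reduction to one-dimensional integrals *)

Section Homog.
Variable R : realType.
Implicit Types (p q : {poly R}) (x y : R) (n : nat).

Lemma homogD n p q x y : homog n (p + q) x y = homog n p x y + homog n q x y.
Proof.
by rewrite /homog -big_split; apply: eq_bigr => m _; rewrite coefD !mulrDl.
Qed.

Lemma homogZ n (a : R) p x y : homog n (a *: p) x y = a * homog n p x y.
Proof. by rewrite mulr_sumr; apply: eq_bigr => m _; rewrite coefZ !mulrA. Qed.

Lemma homogB n p q x y : homog n (p - q) x y = homog n p x y - homog n q x y.
Proof. by rewrite homogD -scaleN1r homogZ mulN1r. Qed.

Lemma homogMX n p x y : homog n.+1 ('X * p) x y = x * homog n p x y.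
Proof.
rewrite /homog big_ord_recl coefXM !mul0r add0r mulr_sumr.
by apply: eq_bigr => m _; rewrite coefXM /= subSS exprS mulrCA !mulrA.
Qed.

Lemma homogS n p x y : (size p <= n.+1)%N ->
  homog n.+1 p x y = y * homog n p x y.
Proof.
move=> sp; rewrite /homog big_ord_recr /= nth_default// !mul0r addr0 mulr_sumr.
by apply: eq_bigr => m _; rewrite subSn 1?leq_ord// exprS mulrCA.
Qed.

Lemma size_bernstein a b : (size (bernstein R a b) <= (a + b).+1)%N.
Proof.
have s1 : (size (1 - 'X : {poly R})%R <= 2)%N.
  by rewrite -opprB size_polyN size_XsubC.
have s2 : (size (1 + 'X : {poly R})%R <= 2)%N by rewrite addrC size_XaddC.
apply: leq_trans (size_polyMleq _ _) _.
have := size_poly_exp_leq (1 - 'X : {poly R}) a.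
have := size_poly_exp_leq (1 + 'X : {poly R}) b.
move: s1 s2; move: (size _) (size _) (size _) (size _) => m1 m2 m3 m4.
by nia.
Qed.

(** For [x = t - s] and [y = t + s] the right-hand side is a monomial in [2 s] and [2 t], to which
    Dirichlet's formula applies. *)
Lemma homog_bernstein a b x y :
  homog (a + b) (bernstein R a b) x y = (y - x) ^+ a * (y + x) ^+ b.
Proof.
elim: a => [|a IHa].
  elim: b => [|b IHb].
    rewrite /homog /bernstein big_ord_recl big_ord0 /= !expr0 !mulr1 coef1.
    by rewrite addr0.
  rewrite addnS bernsteinSr mulrDl mul1r homogD homogMX homogS ?size_bernstein//.
  by rewrite IHb exprS; ring.
rewrite addSn bernsteinSl mulrBl mul1r -scaleN1r homogD homogZ homogMX.
by rewrite homogS ?size_bernstein// IHa exprS; ring.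
Qed.

End Homog.

Section LinearRelation.
Variables (R : realType) (T : Type).
Implicit Types (D : (T -> R) -> R -> Prop) (f g s t r : T -> R).

(* [D f u] reads "[f] is integrable with integral [u]". *)
Definition linear_rel D :=
  (forall f g u v, D f u -> D g v -> D (fun x => f x + g x) (u + v)) /\
  (forall a f u, D f u -> D (fun x => a * f x) (a * u)).

(** Dirichlet's formula on a triangle, with exponent 0 on the third barycentric coordinate and one
    constant for all exponents. *)
Definition dirichlet2 D s t := exists C, forall a b,
  D (fun x => s x ^+ a * t x ^+ b)
    (C * (a`! * b`!)%:R / ((a + b).+2)`!%:R).

Definition dirichlet3 D s t r := exists C, forall a b c,
  D (fun x => s x ^+ a * t x ^+ b * r x ^+ c)
    (C * (a`! * b`! * c`!)%:R / ((a + b + c).+3)`!%:R).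

Variable D : (T -> R) -> R -> Prop.
Hypothesis linD : linear_rel D.

Lemma fact_neq0 n : n`!%:R != 0 :> R.
Proof. by rewrite pnatr_eq0 -lt0n fact_gt0. Qed.

(** Splitting one factor [t + s] raises either [a] or [b], and the two factorial terms add up
    through [(a + 1) + (b + 1) = a + b + 2]. Such factors arise from homogenising in [r - y],
    [r + y] with [y = t + s]. *)
Lemma dirichlet3_sum C s t r :
  (forall a b c, D (fun x => s x ^+ a * t x ^+ b * r x ^+ c)
    (C * (a`! * b`! * c`!)%:R / ((a + b + c).+3)`!%:R)) ->
  forall e a b c,
  D (fun x => s x ^+ a * t x ^+ b * r x ^+ c * (t x + s x) ^+ e)
    (C * (a`! * b`! * c`!)%:R * ((a + b + e).+1)`!%:R / ((a + b).+1)`!%:R /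
       ((a + b + c + e).+3)`!%:R).
Proof.
move=> dD; elim=> [|e IHe] a b c.
  under eq_fun do rewrite expr0 mulr1.
  by rewrite !addn0 mulfK ?fact_neq0//; exact: dD.
have [+ _] := linD => /(_ _ _ _ _ (IHe a.+1 b c) (IHe a b.+1 c)).
congr D.
  by apply/funext => x; rewrite !exprS; ring.
rewrite !(addSn, addnS) !(factS a, factS b, factS (a + b).+1) !natrM.
field.
by rewrite !fact_neq0 -?natrD !nat1r !pnatr_eq0.
Qed.

Lemma duffy2 s t : dirichlet2 D s t -> forall n a b, exists K,
  forall P : {poly R}, (size P <= n.+1)%N ->
  D (fun x => homog n P (t x - s x) (t x + s x) * (s x ^+ a * t x ^+ b))
    (K * pint1 (P * bernstein R a b)).
Proof.
move=> [C dD] n a b.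
(* The quotient of Dirichlet's formula by [pint_bernstein] on a Bernstein product: the factorials of
   the single exponents cancel, so it depends on the total degree only. The factor [2 ^+ n] comes
   from the arguments [2 s] and [2 t]. *)
exists (C * 2 ^+ n / ((n + a + b).+2%:R * 2 ^+ (n + a + b).+1)).
apply: (@bernstein_ind R _ n) => [p q Dp Dq|k p Dp|a' b' ab].
- have [+ _] := linD => /(_ _ _ _ _ Dp Dq); congr D.
    by apply/funext => x; rewrite homogD mulrDl.
  by rewrite -mulrDr [(p + q) * _]mulrDl /pint1 pintD.
- have [_] := linD => /(_ k _ _ Dp); congr D.
    by apply/funext => x; rewrite homogZ mulrA.
  by rewrite -[k *: p * _]scalerAl /pint1 pintZ mulrCA.
have [_ /(_ (2 ^+ n) _ _ (dD (a' + a)%N (b' + b)%N))] := linD; congr D.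
  apply/funext => x; rewrite -ab homog_bernstein.
  have -> : t x + s x - (t x - s x) = 2 * s x by ring.
  have -> : t x + s x + (t x - s x) = 2 * t x by ring.
  by rewrite !exprMn !exprD; ring.
rewrite bernsteinM pint_bernstein -ab.
have -> : (a' + a + (b' + b) = a' + b' + a + b)%N by lia.
set N := (a' + b' + a + b)%N.
rewrite (factS N.+1).
have h1 := fact_neq0 N.+1.
have h2 : 2 ^+ N.+1 != 0 :> R by rewrite expf_neq0 ?pnatr_eq0.
have h3 : N.+2%:R != 0 :> R by rewrite pnatr_eq0.
move: h1 h2 h3; rewrite [(N.+2 * _)%:R]natrM [(_`! * _`!)%:R]natrM.
move: (N.+1)`!%:R (2 ^+ N.+1) (N.+2%:R) => u v w *.
by field; apply/and3P; split.
Qed.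

(* Integration in the coordinates [t - s], [t + s = y] and [r - y], [r + y],
   with the factors [y] and [r + y] of the Jacobians. *)
Lemma duffy3 s t r : dirichlet3 D s t r -> forall m n a b c, exists K,
  forall P Q : {poly R}, (size P <= m.+1)%N -> (size Q <= n.+1)%N ->
  D (fun x => homog m P (t x - s x) (t x + s x) *
              homog n Q (r x - (t x + s x)) (r x + (t x + s x)) *
              (s x ^+ a * t x ^+ b * r x ^+ c))
    (K * (pint1 (P * bernstein R a b) *
          pint1 (Q * bernstein R (m + a + b).+1 c))).
Proof.
move=> [C dD] m n a b c; pose N := (m + n + a + b + c)%N.
(* Again a quotient, now by two beta integrals whose exponents sum to [m + a + b] and to [N + 1]. *)
exists (C * 2 ^+ m * 2 ^+ n / (N.+3%:R * 2 ^+ N.+2 * 2 ^+ (m + a + b).+1)).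
move=> P Q sP sQ; move: P sP.
apply: (@bernstein_ind R _ m) => [p q Dp Dq|k p Dp|a' b' ab].
- have [+ _] := linD => /(_ _ _ _ _ Dp Dq); congr D.
    by apply/funext => x; rewrite homogD !mulrDl.
  by rewrite [(p + q) * _]mulrDl /pint1 pintD; ring.
- have [_] := linD => /(_ k _ _ Dp); congr D.
    by apply/funext => x; rewrite homogZ !mulrA.
  by rewrite -[k *: p * _]scalerAl /pint1 pintZ; ring.
move: Q sQ; apply: (@bernstein_ind R _ n) => [p q Dp Dq|k p Dp|a'' b'' ab'].
- have [+ _] := linD => /(_ _ _ _ _ Dp Dq); congr D.
    by apply/funext => x; rewrite homogD mulrDr !mulrDl.
  by rewrite [(p + q) * _]mulrDl /pint1 pintD; ring.
- have [_] := linD => /(_ k _ _ Dp); congr D.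
    by apply/funext => x; rewrite homogZ; ring.
  by rewrite -[k *: p * _]scalerAl /pint1 pintZ; ring.
have [_ /(_ (2 ^+ m * 2 ^+ n) _ _
  (dirichlet3_sum dD a'' (a' + a)%N (b' + b)%N (b'' + c)%N))] := linD; congr D.
  apply/funext => x; rewrite -ab -ab' !homog_bernstein.
  have -> : t x + s x - (t x - s x) = 2 * s x by ring.
  have -> : t x + s x + (t x - s x) = 2 * t x by ring.
  have -> : r x + (t x + s x) - (r x - (t x + s x)) = 2 * (t x + s x) by ring.
  have -> : r x + (t x + s x) + (r x - (t x + s x)) = 2 * r x by ring.
  by rewrite !exprMn !exprD; ring.
rewrite !bernsteinM !pint_bernstein.
have -> : (a' + a + (b' + b) + (b'' + c) + a'' = N)%N by rewrite /N; lia.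
have -> : (a'' + (m + a + b).+1 + (b'' + c) = N.+1)%N by rewrite /N; lia.
have -> : (a'' + (m + a + b).+1 = (m + a + b + a'').+1)%N by lia.
have -> : (a' + a + (b' + b) = m + a + b)%N by lia.
rewrite (factS N.+2) [(N.+3 * _)%:R]natrM ![(_`! * _`!)%:R]natrM.
rewrite [(_`! * _`! * _`!)%:R]natrM.
have := fact_neq0 N.+2.
have : 2 ^+ N.+2 != 0 :> R by rewrite expf_neq0 ?pnatr_eq0.
have : N.+3%:R != 0 :> R by rewrite pnatr_eq0.
have : 2 ^+ (m + a + b).+1 != 0 :> R by rewrite expf_neq0 ?pnatr_eq0.
have := fact_neq0 (m + a + b).+1.
move: (2 ^+ _) (2 ^+ _) (_`!%:R) (_`!%:R) N.+3%:R => *.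
by field; apply/and5P; split.
Qed.

Definition affine3 s t r (l : T -> R) := exists c0 c1 c2 c3 : R,
  forall x, l x = c0 + c1 * s x + c2 * t x + c3 * r x.

(** An affine substitution does not raise the degree; this carries orthogonality from barycentric to
    Cartesian monomials. *)
Lemma affine3_orthogonal s t r f N :
  (forall a b c, (a + b + c <= N)%N ->
     D (fun x => f x * (s x ^+ a * t x ^+ b * r x ^+ c)) 0) ->
  forall l1 l2 l3, affine3 s t r l1 -> affine3 s t r l2 -> affine3 s t r l3 ->
  forall a b c, (a + b + c <= N)%N ->
     D (fun x => f x * (l1 x ^+ a * l2 x ^+ b * l3 x ^+ c)) 0.
Proof.
move=> D0 l1 l2 l3 a1 a2 a3 a b c abc.
(* The number [m] is the degree already spent on [g]: each affine factor moved into [g] costs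
   one. *)
pose Z m g := forall a b c, (a + b + c + m <= N)%N ->
  D (fun x => f x * (s x ^+ a * t x ^+ b * r x ^+ c * g x)) 0.
have Z0 : Z 0%N (fun=> 1).
  move=> *; under eq_fun do rewrite mulr1; apply: D0; lia.
have ZM l m g : affine3 s t r l -> Z m g -> Z m.+1 (fun x => l x * g x).
  move=> [c0 [c1 [c2 [c3 le]]]] Zg a' b' c' abc'.
  have [DD DZ] := linD.
  have lt : (a' + b' + c' + m <= N)%N by lia.
  have lt1 : (a'.+1 + b' + c' + m <= N)%N by lia.
  have lt2 : (a' + b'.+1 + c' + m <= N)%N by lia.
  have lt3 : (a' + b' + c'.+1 + m <= N)%N by lia.
  have := DD _ _ _ _ (DD _ _ _ _ (DD _ _ _ _ (DZ c0 _ _ (Zg _ _ _ lt))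
    (DZ c1 _ _ (Zg _ _ _ lt1))) (DZ c2 _ _ (Zg _ _ _ lt2)))
    (DZ c3 _ _ (Zg _ _ _ lt3)).
  rewrite !mulr0 !addr0; congr D; apply/funext => x; rewrite le !exprS; ring.
have ZX l n m g : affine3 s t r l -> Z m g ->
    Z (n + m)%N (fun x => l x ^+ n * g x).
  move=> al Zg; elim: n => [|n IHn]; first by under eq_fun do rewrite mul1r.
  by under eq_fun do rewrite exprS -mulrA; exact: ZM.
have := ZX _ a _ _ a1 (ZX _ b _ _ a2 (ZX _ c _ _ a3 Z0)).
move=> /(_ 0 0 0)%N; rewrite !add0n addn0 addnA => /(_ abc); congr D.
by apply/funext => x; ring.
Qed.

End LinearRelation.

(** * Dirichlet's formula on the simplices *)

Section Integration.
Variable R : realType.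

Lemma integral_itv_horner (u v : R) (p : {poly R}) : u <= v ->
  (\int[lebesgue_measure]_(x in `[u, v]) (p.[x])%:E = (pint u v p)%:E)%E.
Proof.
rewrite le_eqVlt => /predU1P[->|uv].
  by rewrite set_itv1 integral_set1 /pint subrr.
rewrite (@continuous_FTC2 _ _ (horner (primitive p)))//.
- by apply: continuous_subspaceT; exact: continuous_horner.
- split; first by move=> y _; exact: derivable_horner.
  + by apply: cvg_at_right_filter; exact: continuous_horner.
  + by apply: cvg_at_left_filter; exact: continuous_horner.
- by move=> y _; rewrite -derivE deriv_primitive.
Qed.

Lemma integral_beta (u v k : R) a b : u <= v ->
  (\int[lebesgue_measure]_(x in `[u, v])
     (k * ((v - x) ^+ a * (x - u) ^+ b))%:E =
   (k * ((v - u) ^+ (a + b).+1 * (a`! * b`!)%:R / ((a + b).+1)`!%:R))%:E)%E.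
Proof.
move=> uv; rewrite -pint_beta -pintZ -integral_itv_horner//.
by apply: eq_integral => x _; rewrite !(hornerE, horner_exp).
Qed.

Lemma ge0_integral_slice d (T : measurableType d)
    (m : {sigma_finite_measure set T -> \bar R}) (S : set (T * R))
    (f : T * R -> R) :
  measurable S -> measurable_fun setT f -> (forall x, S x -> 0 <= f x) ->
  (\int[m \x @lebesgue_measure R]_(x in S) (f x)%:E =
   \int[lebesgue_measure]_y \int[m]_(x in [set x | S (x, y)]) (f (x, y))%:E)%E.
Proof.
move=> mS mf f0; rewrite integral_mkcond fubini_tonelli2.
- apply: eq_integral => y _; rewrite [RHS]integral_mkcond.
  apply: eq_integral => x _; rewrite !patchE.
  by congr (if _ then _ else _); apply/idP/idP; rewrite !inE.
- apply/(measurable_restrictT _ _).1 => //.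
  by apply/measurable_EFinP; exact: measurable_funS mf.
- move=> x; rewrite patchE; case: ifPn => //; rewrite inE => Sx.
  by rewrite lee_fin f0.
Qed.

(** The reference triangle for [h = 1]; in general the slice of the reference tetrahedron at height
    [1 - h], empty for [h < 0]. *)
Definition triangle (h : R) : set (R * R) :=
  [set x | [/\ 0 <= x.2, 0 <= h - x.2 - x.1 & 0 <= h - x.2 + x.1]].

Lemma measurable_triangle h : measurable (triangle h).
Proof.
have mge0 (g : R * R -> R) : measurable_fun setT g ->
    measurable [set x | 0 <= g x].
  move=> mg; rewrite -[X in measurable X]setTI.
  by apply: measurable_fun_le => //; exact: measurable_cst.
have -> : triangle h = [set x | 0 <= x.2] `&` [set x | 0 <= h - x.2 - x.1] `&`
    [set x | 0 <= h - x.2 + x.1].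
  by apply/seteqP; split => [x [? ? ?]|x [[? ?] ?]].
have m2 : measurable_fun setT (fun x : R * R => h - x.2).
  by apply: measurable_funB => //; exact: measurable_snd.
apply: measurableI; [apply: measurableI|]; apply: mge0.
- exact: measurable_snd.
- by apply: measurable_funB => //; exact: measurable_fst.
- by apply: measurable_funD => //; exact: measurable_fst.
Qed.

End Integration.

(* The instance of the library for the product of sigma-finite measures is
   hidden by the one for subprobabilities, so it is restored on [lebesgue2]. *)
HB.instance Definition _ (R : realType) := Measure.on (@lebesgue2 R).
Lemma sigma_finite_lebesgue2 (R : realType) : sigma_finite setT (@lebesgue2 R).
Proof.
exact: (isSigmaFinite.sigma_finiteT
  (measure_function_Measure_isSigmaFinite__to__measure_function_isSigmaFinite
     (@lebesgue_measure R) (@lebesgue_measure R))).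
Qed.
HB.instance Definition _ (R : realType) :=
  Measure_isSigmaFinite.Build _ _ _ (@lebesgue2 R) (@sigma_finite_lebesgue2 R).

Section SimplexIntegrals.
Variable R : realType.

Lemma measurable_fun_affine2 (c0 c1 c2 : R) :
  measurable_fun setT (fun x : R * R => c0 + c1 * x.1 + c2 * x.2).
Proof.
apply: measurable_funD; first apply: measurable_funD => //.
- by apply: measurable_funM => //; exact: measurable_fst.
- by apply: measurable_funM => //; exact: measurable_snd.
Qed.

Lemma measurable_fun_affine3 (c0 c1 c2 c3 : R) :
  measurable_fun setT
    (fun x : R * R * R => c0 + c1 * x.1.1 + c2 * x.1.2 + c3 * x.2).
Proof.
apply: measurable_funD; last first.
  by apply: measurable_funM => //; exact: measurable_snd.
have := measurableT_comp (measurable_fun_affine2 c0 c1 c2)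
  (@measurable_fst _ _ (R * R)%type R).
exact.
Qed.

Definition mono2 (h : R) a b c (x : R * R) : R :=
  ((h - x.2 - x.1) / 2) ^+ a * ((h - x.2 + x.1) / 2) ^+ b * x.2 ^+ c.

Lemma measurable_mono2 h a b c : measurable_fun setT (mono2 h a b c).
Proof.
have -> : mono2 h a b c = (fun x : R * R =>
    (h / 2 + (- 2^-1) * x.1 + (- 2^-1) * x.2) ^+ a *
    (h / 2 + 2^-1 * x.1 + (- 2^-1) * x.2) ^+ b * x.2 ^+ c).
  by apply/funext => x; rewrite /mono2; congr (_ ^+ _ * _ ^+ _ * _); field.
by apply: measurable_funM; [apply: measurable_funM|]; apply: measurable_funX;
  [exact: measurable_fun_affine2..|exact: measurable_snd].
Qed.

Lemma mono2_ge0 h a b c x : triangle h x -> 0 <= mono2 h a b c x.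
Proof. by move=> [? ? ?]; rewrite !mulr_ge0 ?exprn_ge0 ?divr_ge0. Qed.

(** Horizontal slicing gives a beta integral over [-(h - y), h - y] and then one over [0, h]. The
    factor [k] makes room for the power of the third coordinate in the tetrahedron. *)
Lemma integral_triangle (h k : R) a b c : 0 <= k ->
  (\int[@lebesgue2 R]_(x in triangle h) (k * mono2 h a b c x)%:E =
   (k * (if h < 0 then 0 else 2 * h ^+ (a + b + c).+2 *
      (a`! * b`! * c`!)%:R / ((a + b + c).+2)`!%:R))%:E)%E.
Proof.
move=> k0; rewrite ge0_integral_slice; last 3 first.
- exact: measurable_triangle.
- by apply: measurable_funM => //; exact: measurable_mono2.
- by move=> x hx; rewrite mulr_ge0// mono2_ge0.
(* The inner interval has length [2 (h - y)]; of the resulting [2 ^+ (a + b).+1] the halves in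
   [mono2] leave a single 2. *)
pose K := k * (2 * (a`! * b`!)%:R / ((a + b).+1)`!%:R).
have inner (y : R) :
    (\int[lebesgue_measure]_(x in [set x | triangle h (x, y)])
      (k * mono2 h a b c (x, y))%:E =
     ((fun y : R => (K * ((h - y) ^+ (a + b).+1 * (y - 0) ^+ c))%:E)
        \_ `[0%R, h]) y)%E.
  rewrite patchE; case: ifPn => [|hy].
    rewrite inE /= in_itv /= => /andP[y0 yh].
    have -> : [set x : R | triangle h (x, y)] = [set` `[- (h - y), h - y]].
      apply/seteqP; split => x; rewrite /= in_itv /= /triangle /=.
        by move=> [? ? ?]; apply/andP; split; lra.
      by move=> /andP[? ?]; split; lra.
    under eq_integral => x _.
      have -> : k * mono2 h a b c (x, y) =
          (k * 2^-1 ^+ a * 2^-1 ^+ b * y ^+ c) *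
          ((h - y - x) ^+ a * (x - - (h - y)) ^+ b).
        by rewrite /mono2 /= opprK !exprMn (addrC x); ring.
      over.
    rewrite /= integral_beta; last by lra.
    congr (_%:E); have -> : h - y - - (h - y) = 2 * (h - y) by ring.
    rewrite /K subr0 exprMn exprS exprD !exprVn.
    have e0 n : 2 ^+ n != 0 :> R by rewrite expf_neq0 ?pnatr_eq0.
    by field; rewrite ?e0 ?fact_neq0.
  rewrite (_ : [set x | _] = set0) ?integral_set0//.
  apply/seteqP; split => // x /=; rewrite /triangle /= => -[y0 h1 h2].
  by move: hy => /negP; apply; rewrite inE /= in_itv /=; apply/andP; split; lra.
under eq_integral do rewrite inner.
rewrite -integral_mkcond; case: ltP => h0.
  rewrite mulr0 set_itv_ge ?integral_set0// bnd_simp.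
  by apply/negP => /(le_lt_trans)/(_ h0); rewrite ltxx.
rewrite integral_beta// subr0 /K; congr (_%:E).
have -> : ((a + b).+1 + c).+1 = (a + b + c).+2 by lia.
rewrite ![(_`! * _`!)%:R]natrM [(_`! * _`! * _`!)%:R]natrM.
rewrite ![(_`! * _`!)%:R]natrM.
by field; rewrite !fact_neq0.
Qed.

Definition tetrahedron : set (R * R * R) :=
  [set x | 0 <= x.2 /\ triangle (1 - x.2) x.1].

Definition mono3 a b c d (x : R * R * R) : R :=
  mono2 (1 - x.2) a b c x.1 * x.2 ^+ d.

Lemma measurable_mono3 a b c d : measurable_fun setT (mono3 a b c d).
Proof.
have -> : mono3 a b c d = (fun x : R * R * R =>
    (1 / 2 + (- 2^-1) * x.1.1 + (- 2^-1) * x.1.2 + (- 2^-1) * x.2) ^+ a *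
    (1 / 2 + 2^-1 * x.1.1 + (- 2^-1) * x.1.2 + (- 2^-1) * x.2) ^+ b *
    (0 + 0 * x.1.1 + 1 * x.1.2 + 0 * x.2) ^+ c * x.2 ^+ d).
  apply/funext => x; rewrite /mono3 /mono2.
  by congr (_ ^+ _ * _ ^+ _ * _ ^+ _ * _); field.
apply: measurable_funM; [apply: measurable_funM; [apply: measurable_funM|]|];
  apply: measurable_funX;
  [exact: measurable_fun_affine3..|exact: measurable_snd].
Qed.

Lemma mono3_ge0 a b c d x : tetrahedron x -> 0 <= mono3 a b c d x.
Proof. by move=> [? ?]; rewrite mulr_ge0 ?mono2_ge0 ?exprn_ge0. Qed.

Lemma measurable_tetrahedron : measurable tetrahedron.
Proof.
have mge0 (c0 c1 c2 c3 : R) : measurable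
    [set x : R * R * R | 0 <= c0 + c1 * x.1.1 + c2 * x.1.2 + c3 * x.2].
  rewrite -[X in measurable X]setTI.
  by apply: measurable_fun_le => //; exact: measurable_fun_affine3.
have -> : tetrahedron =
    [set x : R * R * R | 0 <= 0 + 0 * x.1.1 + 0 * x.1.2 + 1 * x.2] `&`
    [set x : R * R * R | 0 <= 0 + 0 * x.1.1 + 1 * x.1.2 + 0 * x.2] `&`
    [set x : R * R * R | 0 <= 1 + (-1) * x.1.1 + (-1) * x.1.2 + (-1) * x.2] `&`
    [set x : R * R * R | 0 <= 1 + 1 * x.1.1 + (-1) * x.1.2 + (-1) * x.2].
  apply/seteqP; split => x; rewrite /tetrahedron /triangle /=.
    by move=> [? [? ? ?]]; repeat split; lra.
  by move=> [[[? ?] ?] ?]; repeat split; lra.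
by do 3?apply: measurableI; exact: mge0.
Qed.

Lemma integral_tetrahedron a b c d :
  (\int[@lebesgue3 R]_(x in tetrahedron) (mono3 a b c d x)%:E =
   (2 * (a`! * b`! * c`! * d`!)%:R / ((a + b + c + d).+3)`!%:R)%:E)%E.
Proof.
have := @ge0_integral_slice R _ _ (@lebesgue2 R) tetrahedron (mono3 a b c d)
  measurable_tetrahedron (measurable_mono3 a b c d) (@mono3_ge0 a b c d).
rewrite -/(@lebesgue3 R) => ->.
pose K : R := 2 * (a`! * b`! * c`!)%:R / ((a + b + c).+2)`!%:R.
have inner (z : R) :
    (\int[@lebesgue2 R]_(x in [set x | tetrahedron (x, z)])
      (mono3 a b c d (x, z))%:E =
     ((fun z : R => (K * ((1 - z) ^+ (a + b + c).+2 * (z - 0) ^+ d))%:E)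
        \_ `[0%R, 1%R]) z)%E.
  have [z0|z0] := leP 0 z; last first.
    rewrite (_ : [set x | _] = set0) ?integral_set0//; last first.
      by apply/seteqP; split => // x /= [/=]; lra.
    by rewrite patchE memNset//= in_itv /=; lra.
  have -> : [set x | tetrahedron (x, z)] = triangle (1 - z).
    by apply/seteqP; split => x /=; [move=> []|].
  (* On the slice at height [z] the constant [z ^+ d] takes the place of [k]. *)
  under eq_integral => x _ do rewrite /mono3 /= mulrC.
  rewrite integral_triangle ?exprn_ge0// patchE; case: ltP => z1.
    by rewrite mulr0 memNset//= in_itv /=; lra.
  rewrite mem_set/= ?in_itv /=; last by lra.
  by rewrite subr0 /K; congr (_%:E); ring.
under eq_integral do rewrite inner.
rewrite -integral_mkcond integral_beta// /K subr0 expr1n; congr (_%:E).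
have -> : ((a + b + c).+2 + d).+1 = (a + b + c + d).+3 by lia.
rewrite [(_`! * _`! * _`! * _`!)%:R]natrM [((a + b + c).+2`! * _`!)%:R]natrM.
by field; rewrite !fact_neq0.
Qed.

End SimplexIntegrals.

(** * Derivatives of the facet functions *)

Section HomogDerivative.
Variable R : realType.
Implicit Types (p q : {poly R}) (n : nat).

(** By Euler's relation, [homog n] of this polynomial is the derivative of [homog n.+1 p] in its
    second variable. *)
Definition hderiv n p : {poly R} := n.+1%:R *: p - 'X * p^`().

Lemma coef_hderiv n p m : (hderiv n p)`_m = (n.+1%:R - m%:R) * p`_m.
Proof.
rewrite /hderiv coefB coefZ coefXM coef_deriv.
by case: m => [|m] /=; [ring|rewrite mulrBl !mulr_natl].
Qed.

(** In degree [n + 1] the contributions of [(n + 1) p] and of [X] times the derivative cancel. *)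
Lemma size_hderiv n p : (size p <= n.+2)%N -> (size (hderiv n p) <= n.+1)%N.
Proof.
move=> sp; apply/leq_sizeP => m.
rewrite leq_eqVlt coef_hderiv => /predU1P[<-|nm].
  by rewrite subrr mul0r.
by rewrite nth_default ?mulr0// (leq_trans sp).
Qed.

Lemma is_derive_exprn (x : R -> R) (t dx : R) m : is_derive t 1 x dx ->
  is_derive t 1 (fun u => x u ^+ m) (m%:R * x t ^+ m.-1 * dx).
Proof.
by move=> hx; have := is_deriveX m hx; rewrite exprfctE.
Qed.

Lemma is_derive_homog n p (x y : R -> R) (t dx dy : R) :
  is_derive t 1 x dx -> is_derive t 1 y dy ->
  is_derive t 1 (fun u => homog n.+1 p (x u) (y u))
    (dx * homog n p^`() (x t) (y t) + dy * homog n (hderiv n p) (x t) (y t)).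
Proof.
move=> hx hy.
pose k (m : 'I_n.+2) := (n.+1 - m)%N.
pose h (m : 'I_n.+2) u := p`_m * (x u ^+ m * y u ^+ k m).
pose dh (m : 'I_n.+2) := p`_m * (x t ^+ m * (k m)%:R * y t ^+ (k m).-1 * dy +
  y t ^+ k m * m%:R * x t ^+ m.-1 * dx).
have hdh m : is_derive t 1 (h m) (dh m).
  have := is_deriveZ p`_m (is_deriveM (is_derive_exprn m hx)
    (is_derive_exprn (k m) hy)).
  by rewrite /GRing.scale /= /dh !mulrA.
have -> : (fun u => homog n.+1 p (x u) (y u)) = \sum_m h m.
  apply/funext => u; rewrite fct_sumE.
  by apply: eq_bigr => m _; rewrite /h mulrA.
apply: (is_derive_eq (is_derive_sum hdh)).
have -> : \sum_m dh m =
    \sum_(m < n.+2) dx * (p`_m * (m%:R * x t ^+ m.-1) * y t ^+ k m) +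
    \sum_(m < n.+2) dy * ((k m)%:R * p`_m * x t ^+ m * y t ^+ (k m).-1).
  by rewrite -big_split; apply: eq_bigr => m _; rewrite /dh /=; ring.
(* The truncated exponents [m.-1] at [m = 0] and [(k m).-1] at [k m = 0] are harmless: these terms
   carry a factor 0. *)
rewrite /homog !mulr_sumr; congr (_ + _).
  rewrite big_ord_recl /= mul0r mulr0 mul0r mulr0 add0r.
  apply: eq_bigr => m _; rewrite coef_deriv /k /bump leq0n !add1n subSS add0n.
  by rewrite -[_ *+ m.+1]mulr_natl; ring.
rewrite big_ord_recr /= /k subnn !mul0r mulr0 addr0.
apply: eq_bigr => m _; rewrite coef_hderiv /= natrB ?(ltnW (ltn_ord m))//.
by rewrite subSn 1?leq_ord.
Qed.

End HomogDerivative.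

(** * Monomial integrals over the reference simplices *)

HB.instance Definition _ (R : realType) := Measure.on (@lebesgue3 R).

Section HasIntegral.
Context d (T : measurableType d) (R : realType).
Variables (mu : {measure set T -> \bar R}) (S : set T).
Hypothesis mS : measurable S.

(** Integrability is built in because additivity of the integral relies on it. *)
Definition has_integral (f : T -> R) (v : R) :=
  mu.-integrable S (EFin \o f) /\ (\int[mu]_(x in S) (f x)%:E = v%:E)%E.

Lemma has_integral_linear : linear_rel has_integral.
Proof.
split=> [f g u v [fi fu] [gi gv]|a f u [fi fu]]; split.
- exact: (integrableD mS fi gi).
- by rewrite (integralD_EFin mS fi gi) /= fu gv.
- exact: (integrableZl mS a fi).
- by under eq_integral do rewrite EFinM; rewrite (integralZl mS fi) fu.
Qed.

Lemma ge0_has_integral (f : T -> R) v : measurable_fun setT f ->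
  (forall x, S x -> 0 <= f x) ->
  (\int[mu]_(x in S) (f x)%:E = v%:E)%E -> has_integral f v.
Proof.
move=> mf f0 fv; split=> //; apply/integrableP; split.
  by apply/measurable_EFinP; exact: measurable_funS mf.
rewrite (eq_integral (fun x => (f x)%:E)) ?fv ?ltry// => x /set_mem Sx.
by rewrite /= ger0_norm ?f0.
Qed.

End HasIntegral.

Section Facets.
Variable R : realType.

Lemma simplex2E : @simplex2 R = triangle 1.
Proof.
apply/seteqP; split => [x [c [c0 c1 ->]]|x [h0 h1 h2]].
  move: c1; have := c0 ord0; have := c0 (lift ord0 ord0).
  have := c0 (lift ord0 (lift ord0 ord0)).
  rewrite /triangle !big_ord_recl !big_ord0 /vertex2 /= /GRing.scale /=.
  by rewrite /GRing.scale /= => *; split; lra.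
exists (fun i => bary2 i x); split; [|exact: sum_bary2|exact: bary2E].
by move=> [[|[|[|//]]] ?]; rewrite /bary2 /=; lra.
Qed.

Lemma simplex3E : @simplex3 R = @tetrahedron R.
Proof.
apply/seteqP; split => [x [c [c0 c1 ->]]|x [h [h0 h1 h2]]].
  move: c1; have := c0 ord0; have := c0 (lift ord0 ord0).
  have := c0 (lift ord0 (lift ord0 ord0)).
  have := c0 (lift ord0 (lift ord0 (lift ord0 ord0))).
  rewrite /tetrahedron /triangle !big_ord_recl !big_ord0 /vertex3 /=.
  rewrite /GRing.scale /=.
  by do 2?rewrite /GRing.scale /=; move=> *; repeat split; lra.
exists (fun i => bary3 i x); split; [|exact: sum_bary3|exact: bary3E].
by move=> [[|[|[|[|//]]]] ?]; rewrite /bary3 /=; lra.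
Qed.

Definition simplex2_integral := has_integral (@lebesgue2 R) (@simplex2 R).
Definition simplex3_integral := has_integral (@lebesgue3 R) (@simplex3 R).

Lemma simplex2_integral_linear : linear_rel simplex2_integral.
Proof.
by apply: has_integral_linear; rewrite simplex2E; exact: measurable_triangle.
Qed.

Lemma simplex3_integral_linear : linear_rel simplex3_integral.
Proof.
by apply: has_integral_linear; rewrite simplex3E; exact: measurable_tetrahedron.
Qed.

Lemma simplex2_integral_mono a b c :
  simplex2_integral (mono2 1 a b c)
    (2 * (a`! * b`! * c`!)%:R / ((a + b + c).+2)`!%:R).
Proof.
rewrite /simplex2_integral simplex2E; apply: ge0_has_integral => [|x|].
- exact: measurable_mono2.
- exact: mono2_ge0.
have := @integral_triangle R 1 1 a b c ler01.
rewrite ltr10 expr1n mulr1 mul1r => <-.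
by under [RHS]eq_integral do rewrite mul1r.
Qed.

Lemma simplex3_integral_mono a b c d : simplex3_integral (@mono3 R a b c d)
  (2 * (a`! * b`! * c`! * d`!)%:R / ((a + b + c + d).+3)`!%:R).
Proof.
rewrite /simplex3_integral simplex3E; apply: ge0_has_integral => [|x|].
- exact: measurable_mono3.
- exact: mono3_ge0.
exact: integral_tetrahedron.
Qed.

(** The vertex off the edge gets exponent 0; the symmetry of the formula covers the edge that runs
    against the order of the vertices. *)
Lemma dirichlet2_edges (f1 f2 : 'I_3) : (f1, f2) \in edges ->
  dirichlet2 simplex2_integral (bary2 f1) (bary2 f2).
Proof.
rewrite !inE => /or3P[] /eqP[-> ->]; exists 2 => a b.
- have := simplex2_integral_mono a b 0.
  congr simplex2_integral; last by rewrite fact0 muln1 addn0.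
  apply/funext => x; rewrite /mono2 /bary2 /= mulr1.
  by congr (_ ^+ _ * _ ^+ _); field.
- have := simplex2_integral_mono 0 a b.
  congr simplex2_integral; last by rewrite fact0 mul1n add0n.
  apply/funext => x; rewrite /mono2 /bary2 /= mul1r.
  by congr (_ ^+ _ * _ ^+ _); field.
- have := simplex2_integral_mono b 0 a.
  congr simplex2_integral; last by rewrite fact0 muln1 addn0 mulnC addnC.
  apply/funext => x; rewrite /mono2 /bary2 /= mulr1 mulrC.
  by congr (_ ^+ _ * _ ^+ _); field.
Qed.

Lemma dirichlet3_faces (f1 f2 f3 : 'I_4) : (f1, f2, f3) \in faces ->
  dirichlet3 simplex3_integral (bary3 f1) (bary3 f2) (bary3 f3).
Proof.
have bE (x : R * R * R) :
    ((1 - x.2 - x.1.2 - x.1.1) / 2 = (1 - x.1.1 - x.1.2 - x.2) / 2) *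
    ((1 - x.2 - x.1.2 + x.1.1) / 2 = (1 + x.1.1 - x.1.2 - x.2) / 2).
  by split; field.
rewrite !inE => /or4P[] /eqP[-> -> ->]; exists 2 => a b c.
- have := simplex3_integral_mono a b c 0.
  congr simplex3_integral; last by rewrite fact0 muln1 addn0.
  by apply/funext => x; rewrite /mono3 /mono2 /bary3 /= !bE mulr1.
- have := simplex3_integral_mono a 0 b c.
  congr simplex3_integral; last by rewrite fact0 muln1 addn0.
  by apply/funext => x; rewrite /mono3 /mono2 /bary3 /= !bE mulr1.
- have := simplex3_integral_mono a b 0 c.
  congr simplex3_integral; last by rewrite fact0 muln1 addn0.
  by apply/funext => x; rewrite /mono3 /mono2 /bary3 /= !bE mulr1.
- have := simplex3_integral_mono 0 a b c.
  congr simplex3_integral; last by rewrite fact0 mul1n add0n.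
  by apply/funext => x; rewrite /mono3 /mono2 /bary3 /= !bE mul1r.
Qed.

End Facets.

(** * Partial derivatives, gradients and curls *)

Section Partial.
Variables (R : realType) (T : Type) (coord : T -> R) (line : T -> R -> T).
Hypothesis line_coord : forall x, line x (coord x) = x.
Implicit Types f g : T -> R.

(* [line x] moves the coordinate [coord x] of the point [x]. *)
Definition has_partial f g :=
  forall x, is_derive (coord x) 1 (fun t => f (line x t)) (g x).

Lemma has_partialD f g f' g' : has_partial f f' -> has_partial g g' ->
  has_partial (fun x => f x + g x) (fun x => f' x + g' x).
Proof. by move=> hf hg x; exact: is_deriveD (hf x) (hg x). Qed.

Lemma has_partialB f g f' g' : has_partial f f' -> has_partial g g' ->
  has_partial (fun x => f x - g x) (fun x => f' x - g' x).
Proof. by move=> hf hg x; exact: is_deriveB (hf x) (hg x). Qed.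

Lemma has_partialZ a f f' : has_partial f f' ->
  has_partial (fun x => a * f x) (fun x => a * f' x).
Proof.
by move=> hf x; have := is_deriveZ a (hf x); rewrite /GRing.scale.
Qed.

Lemma has_partialM f g f' g' : has_partial f f' -> has_partial g g' ->
  has_partial (fun x => f x * g x) (fun x => f x * g' x + g x * f' x).
Proof.
by move=> hf hg x; have := is_deriveM (hf x) (hg x); rewrite line_coord.
Qed.

Lemma has_partial_homog n (p : {poly R}) f g f' g' :
  has_partial f f' -> has_partial g g' ->
  has_partial (fun x => homog n.+1 p (f x) (g x))
    (fun x => f' x * homog n p^`() (f x) (g x) +
              g' x * homog n (hderiv n p) (f x) (g x)).
Proof.
move=> hf hg x.
by have := is_derive_homog n p (hf x) (hg x); rewrite line_coord.
Qed.

Lemma has_partial_derive1 f g x : has_partial f g ->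
  derive1 (fun t => f (line x t)) (coord x) = g x.
Proof. by move=> /(_ x) h; rewrite derive1E; exact: derive_val. Qed.

End Partial.

Section Coordinates.
Variable R : realType.

Lemma is_derive_affine (f : R -> R) (a t : R) : (forall u, f u = a * u + f 0) ->
  is_derive t 1 f a.
Proof.
move=> fE; have -> : f = (fun u => a * u + f 0) by apply/funext.
have := is_deriveD (is_deriveZ a (is_derive_id t 1)) (is_derive_cst (f 0) t 1).
by rewrite /GRing.scale /= mulr1 addr0.
Qed.

Definition has_partial2x := @has_partial R (R * R) (fun x => x.1)
  (fun x t => (t, x.2)).
Definition has_partial2y := @has_partial R (R * R) (fun x => x.2)
  (fun x t => (x.1, t)).

Definition has_partial3x := @has_partial R (R * R * R) (fun x => x.1.1)
  (fun x t => (t, x.1.2, x.2)).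
Definition has_partial3y := @has_partial R (R * R * R) (fun x => x.1.2)
  (fun x t => (x.1.1, t, x.2)).
Definition has_partial3z := @has_partial R (R * R * R) (fun x => x.2)
  (fun x t => (x.1.1, x.1.2, t)).

Lemma bary2_partial (i : 'I_3) : exists a b,
  has_partial2x (bary2 i) (fun=> a) /\ has_partial2y (bary2 i) (fun=> b).
Proof.
exists (nth 0 [:: - 2^-1; 2^-1; 0] i), (nth 0 [:: - 2^-1; - 2^-1; 1] i).
by split=> x; apply: is_derive_affine => u; case: i => [[|[|[|//]]] ?];
  rewrite /bary2 /=; field.
Qed.

Lemma bary3_partial (i : 'I_4) : exists a b c,
  [/\ has_partial3x (bary3 i) (fun=> a), has_partial3y (bary3 i) (fun=> b) &
      has_partial3z (bary3 i) (fun=> c)].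
Proof.
exists (nth 0 [:: - 2^-1; 2^-1; 0; 0] i), (nth 0 [:: - 2^-1; - 2^-1; 1; 0] i),
  (nth 0 [:: - 2^-1; - 2^-1; 0; 1] i).
by split=> x; apply: is_derive_affine => u; case: i => [[|[|[|[|//]]]] ?];
  rewrite /bary3 /=; field.
Qed.

Lemma d3x_has_partial f g : has_partial3x f g -> d3x f = g.
Proof. by move=> h; apply/funext => x; exact: has_partial_derive1 h. Qed.

Lemma d3y_has_partial f g : has_partial3y f g -> d3y f = g.
Proof. by move=> h; apply/funext => x; exact: has_partial_derive1 h. Qed.

Lemma d3z_has_partial f g : has_partial3z f g -> d3z f = g.
Proof. by move=> h; apply/funext => x; exact: has_partial_derive1 h. Qed.

Lemma curl2_has_partial f fx fy : has_partial2x f fx -> has_partial2y f fy ->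
  curl2 f = fun x => (fy x, - fx x).
Proof.
move=> hx hy; apply/funext => x.
rewrite /curl2 /d2x /d2y.
by rewrite (has_partial_derive1 x hx) (has_partial_derive1 x hy).
Qed.

Lemma curl3_has_partial (G : R * R * R -> R * R * R) g1y g1z g2x g2z g3x g3y :
  has_partial3y (fun x => (G x).1.1) g1y ->
  has_partial3z (fun x => (G x).1.1) g1z ->
  has_partial3x (fun x => (G x).1.2) g2x ->
  has_partial3z (fun x => (G x).1.2) g2z ->
  has_partial3x (fun x => (G x).2) g3x ->
  has_partial3y (fun x => (G x).2) g3y ->
  curl3 G = fun x => (g3y x - g2z x, g1z x - g3x x, g2x x - g1y x).
Proof.
by move=> *; rewrite /curl3; do ![erewrite d3x_has_partial by eassumption
  | erewrite d3y_has_partial by eassumption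
  | erewrite d3z_has_partial by eassumption].
Qed.

End Coordinates.

Section FacetFunctions.
Variable R : realType.

Lemma scale_triple (k a b c : R) : k *: (a, b, c) = (k * a, k * b, k * c).
Proof. by []. Qed.

Lemma add_triple (a b c a' b' c' : R) :
  (a, b, c) + (a', b', c') = (a + a', b + b', c + c').
Proof. by []. Qed.

Definition cross (a b : R * R * R) : R * R * R :=
  (a.1.2 * b.2 - a.2 * b.1.2, a.2 * b.1.1 - a.1.1 * b.2,
   a.1.1 * b.1.2 - a.1.2 * b.1.1).

(* [homog n] of these are the derivatives of [homog n.+1 p (r - y) (r + y)] in
   [r] and in [y]. *)
Definition radial n (p : {poly R}) : {poly R} := hderiv n p + p^`().
Definition axial n (p : {poly R}) : {poly R} := hderiv n p - p^`().

(** The mixed second derivatives of [homog n.+2 p] agree. *)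
Lemma deriv_hderiv n (p : {poly R}) : (hderiv n.+1 p)^`() = hderiv n p^`().
Proof.
rewrite /hderiv derivB derivZ derivM derivX mul1r -[in LHS]natr1 scalerDl.
rewrite scale1r.
by rewrite opprD addrA addrK.
Qed.

Definition gradient (f : R * R * R -> R) (g : R * R * R) :=
  [/\ has_partial3x f (fun=> g.1.1), has_partial3y f (fun=> g.1.2) &
      has_partial3z f (fun=> g.2)].

(** The curl of [v grad u] is [cross (grad v) (grad u)], the second derivatives of [u] cancelling by
    [deriv_hderiv]; the chain rule splits each gradient into two terms. *)
Lemma curl3_grad (i j : nat) (p q : {poly R}) (A B C W : R * R * R -> R)
    a b c w :
  gradient A a -> gradient B b -> gradient C c -> gradient W w ->
  curl3 (fun x => homog j.+1 q (C x) (W x) *: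
    grad3 (fun x => homog i.+2 p (A x) (B x)) x) =
  fun x =>
    (homog i.+1 p^`() (A x) (B x) *
       homog j q^`() (C x) (W x)) *: cross c a +
    (homog i.+1 p^`() (A x) (B x) *
       homog j (hderiv j q) (C x) (W x)) *: cross w a +
    (homog i.+1 (hderiv i.+1 p) (A x) (B x) *
       homog j q^`() (C x) (W x)) *: cross c b +
    (homog i.+1 (hderiv i.+1 p) (A x) (B x) *
       homog j (hderiv j q) (C x) (W x)) *: cross w b.
Proof.
move=> [ax ay az] [bx b_y bz] [cx cy cz] [wx wy wz].
have lx x : (x.1.1, x.1.2, x.2) = x :> R * R * R by case: x => [[? ?] ?].
pose u x := homog i.+2 p (A x) (B x).
pose UA x := homog i.+1 p^`() (A x) (B x).
pose UB x := homog i.+1 (hderiv i.+1 p) (A x) (B x).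
have -> : grad3 u = fun x => (a.1.1 * UA x + b.1.1 * UB x,
    a.1.2 * UA x + b.1.2 * UB x, a.2 * UA x + b.2 * UB x).
  rewrite /grad3 (d3x_has_partial (has_partial_homog lx i.+1 p ax bx)).
  rewrite (d3y_has_partial (has_partial_homog lx i.+1 p ay b_y)).
  by rewrite (d3z_has_partial (has_partial_homog lx i.+1 p az bz)).
have vx := has_partial_homog lx j q cx wx.
have vy := has_partial_homog lx j q cy wy.
have vz := has_partial_homog lx j q cz wz.
have UAx := has_partial_homog lx i p^`() ax bx.
have UAy := has_partial_homog lx i p^`() ay b_y.
have UAz := has_partial_homog lx i p^`() az bz.
have UBx := has_partial_homog lx i (hderiv i.+1 p) ax bx.
have UBy := has_partial_homog lx i (hderiv i.+1 p) ay b_y.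
have UBz := has_partial_homog lx i (hderiv i.+1 p) az bz.
rewrite (@curl3_has_partial _ (fun x => homog j.+1 q (C x) (W x) *:
   (a.1.1 * UA x + b.1.1 * UB x,
    a.1.2 * UA x + b.1.2 * UB x, a.2 * UA x + b.2 * UB x)) _ _ _ _ _ _
  (has_partialM lx vy (has_partialD (has_partialZ a.1.1 UAy)
     (has_partialZ b.1.1 UBy)))
  (has_partialM lx vz (has_partialD (has_partialZ a.1.1 UAz)
     (has_partialZ b.1.1 UBz)))
  (has_partialM lx vx (has_partialD (has_partialZ a.1.2 UAx)
     (has_partialZ b.1.2 UBx)))
  (has_partialM lx vz (has_partialD (has_partialZ a.1.2 UAz)
     (has_partialZ b.1.2 UBz)))
  (has_partialM lx vx (has_partialD (has_partialZ a.2 UAx)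
     (has_partialZ b.2 UBx)))
  (has_partialM lx vy (has_partialD (has_partialZ a.2 UAy)
     (has_partialZ b.2 UBy)))).
apply/funext => x; rewrite deriv_hderiv /cross !scale_triple !add_triple.
by rewrite /UA /UB /=; congr (_, _, _); ring.
Qed.

End FacetFunctions.

(** * Orthogonality of the facet functions *)

Section FacetOrthogonality.
Variable R : realType.
Notation bernstein := (bernstein R).
Notation intjacobi := (intjacobi R).

(** The factor [X = (1 + X) - 1] is absorbed into the weight. *)
Lemma hderiv_orthogonal i a b : (a + b + 1 < i)%N ->
  pint1 (hderiv i (intjacobi 0 i.+1) * bernstein a b) = 0.
Proof.
move=> abi; rewrite /hderiv deriv_intjacobi.
have -> : (i.+1%:R *: intjacobi 0 i.+1 - 'X * jacobi R 0 i) * bernstein a b =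
    i.+1%:R *: (intjacobi 0 i.+1 * bernstein a b) -
    (jacobi R 0 i * bernstein a b.+1 - jacobi R 0 i * bernstein a b).
  by rewrite bernsteinSr -!mul_polyC; ring.
rewrite /pint1 !pintB pintZ -!/(pint1 _) intjacobi_orthogonal; try lia.
by rewrite !jacobi_orthogonal ?mulr0 ?subr0//; lia.
Qed.

(** In [radial] the derivative carries the factor [1 - X], which lifts the weight by one; hence
    [al <= a.+1] suffices. *)
Lemma radial_orthogonal al j a b : (al <= a.+1)%N -> (a + b + 1 < al + j)%N ->
  pint1 (radial j (intjacobi al j.+1) * bernstein a b) = 0.
Proof.
move=> ala abj; rewrite /radial /hderiv deriv_intjacobi.
have -> : (j.+1%:R *: intjacobi al j.+1 - 'X * jacobi R al j + jacobi R al j) *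
    bernstein a b = j.+1%:R *: (intjacobi al j.+1 * bernstein a b) +
    jacobi R al j * bernstein a.+1 b.
  by rewrite bernsteinSl -!mul_polyC; ring.
rewrite /pint1 pintD pintZ -!/(pint1 _) intjacobi_orthogonal; try lia.
by rewrite jacobi_orthogonal ?mulr0 ?addr0//; lia.
Qed.

(** Here the derivative carries [1 + X], so the exponent of [1 - X] must reach [al] by itself. *)
Lemma axial_orthogonal al j a b : (al <= a)%N -> (a + b + 1 < al + j)%N ->
  pint1 (axial j (intjacobi al j.+1) * bernstein a b) = 0.
Proof.
move=> ala abj; rewrite /axial /hderiv deriv_intjacobi.
have -> : (j.+1%:R *: intjacobi al j.+1 - 'X * jacobi R al j - jacobi R al j) *
    bernstein a b = j.+1%:R *: (intjacobi al j.+1 * bernstein a b) -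
    jacobi R al j * bernstein a b.+1.
  by rewrite bernsteinSr -!mul_polyC; ring.
rewrite /pint1 pintB pintZ -!/(pint1 _) intjacobi_orthogonal; try lia.
by rewrite jacobi_orthogonal ?mulr0 ?subr0//; lia.
Qed.

(* With [v = homog n.+1 q (r - y) (r + y)], this represents
   [2 (y dv/dy + 2 v)], a coefficient of the curl of [v N_0]. *)
Definition nedelec_poly n (q : {poly R}) : {poly R} :=
  (1 - 'X) * axial n q + 4%:R *: q.

Lemma deriv_bernstein a b : (bernstein a.+1 b.+1)^`() =
  b.+1%:R *: bernstein a.+1 b - a.+1%:R *: bernstein a b.+1.
Proof.
rewrite /bernstein derivM !deriv_exp derivB derivD derivC derivX /=.
by rewrite -!mul_polyC !polyC_natr; ring.
Qed.

(* Integrating the derivative in [axial] by parts cancels the term with the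
   lowest power of [1 - X] when [a = 1]. *)
Lemma nedelec_orthogonal n a b : (1 <= a)%N -> (a + b <= n)%N ->
  pint1 (nedelec_poly n (intjacobi 3 n.+1) * bernstein a b) = 0.
Proof.
move=> a1 abn; set q := intjacobi 3 n.+1.
have parts : pint1 (q^`() * bernstein a.+1 b.+1) =
    - pint1 (q * (bernstein a.+1 b.+1)^`()).
  apply: pint1_parts; last by rewrite intjacobiN1 mul0r.
  suff -> : (bernstein a.+1 b.+1).[1] = 0 by rewrite mulr0.
  by rewrite bernsteinSl hornerM hornerD hornerN hornerX hornerC subrr mul0r.
have -> : nedelec_poly n q * bernstein a b =
    (4%:R *: (q * bernstein a b) + n.+1%:R *: (q * bernstein a.+1 b)) -
    q^`() * bernstein a.+1 b.+1.
  rewrite /nedelec_poly /axial /hderiv bernsteinSl bernsteinSr bernsteinSl.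
  by rewrite -!mul_polyC; ring.
rewrite /pint1 pintB -!/(pint1 _) parts opprK -pintD deriv_bernstein.
have -> : 4%:R *: (q * bernstein a b) + n.+1%:R *: (q * bernstein a.+1 b) +
    q * (b.+1%:R *: bernstein a.+1 b - a.+1%:R *: bernstein a b.+1) =
    (2%:R - 2%:R * a%:R) *: (q * bernstein a b) +
    (n + a + b + 3)%:R *: (q * bernstein a.+1 b).
  rewrite bernstein_split -!mul_polyC rmorphB rmorphM !polyC_natr.
  by rewrite !natrD -!natr1; ring.
rewrite pintD !pintZ -!/(pint1 _) (@intjacobi_orthogonal _ _ _ a.+1); try lia.
case: a a1 abn {parts} => // -[|a] _ abn.
  by rewrite mulr1 subrr mul0r mulr0 addr0.
by rewrite intjacobi_orthogonal ?mulr0 ?addr0//; lia.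
Qed.

End FacetOrthogonality.

Section LinearRelationTheory.
Variables (R : realType) (T : Type) (D : (T -> R) -> R -> Prop).
Hypothesis linD : linear_rel D.

Lemma linear_rel_sum I (r : seq I) (P : pred I) (F : I -> T -> R) :
  D (fun=> 0) 0 -> (forall i, P i -> D (F i) 0) ->
  D (fun x => \sum_(i <- r | P i) F i x) 0.
Proof.
move=> D0 DF; elim: r => [|i r IHr].
  by under eq_fun do rewrite big_nil.
under eq_fun do rewrite big_cons.
case: (boolP (P i)) => // /DF Di.
by have [+ _] := linD => /(_ _ _ _ _ Di IHr); rewrite addr0.
Qed.

Lemma duffy2_eq0 s t n (P : {poly R}) a b :
  dirichlet2 D s t -> (size P <= n.+1)%N -> pint1 (P * bernstein R a b) = 0 ->
  D (fun x => homog n P (t x - s x) (t x + s x) * (s x ^+ a * t x ^+ b)) 0.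
Proof.
move=> dD sP P0; have [K /(_ P sP)] := duffy2 linD dD n a b.
by rewrite P0 mulr0.
Qed.

Lemma duffy3_eq0 s t r m n (P Q : {poly R}) a b c :
  dirichlet3 D s t r -> (size P <= m.+1)%N -> (size Q <= n.+1)%N ->
  (pint1 (P * bernstein R a b) = 0) \/
    (pint1 (Q * bernstein R (m + a + b).+1 c) = 0) ->
  D (fun x => homog m P (t x - s x) (t x + s x) *
              homog n Q (r x - (t x + s x)) (r x + (t x + s x)) *
              (s x ^+ a * t x ^+ b * r x ^+ c)) 0.
Proof.
move=> dD sP sQ PQ0; have [K /(_ P Q sP sQ)] := duffy3 linD dD m n a b c.
by case: PQ0 => ->; rewrite ?mul0r ?mulr0.
Qed.

End LinearRelationTheory.

(** * Edge functions on the triangle *)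

Section TwoDimensional.
Variable R : realType.

(* An edge has two independent barycentric coordinates; the first one also
   serves as the third argument of [affine3]. *)
Lemma affine_edges (f1 f2 : 'I_3) : (f1, f2) \in edges ->
  let affine := affine3 (@bary2 R f1) (@bary2 R f2) (@bary2 R f1) in
  affine (fun x => x.1) /\ affine (fun x => x.2).
Proof.
rewrite !inE => /or3P[] /eqP[-> ->]; split.
- by exists 0, (-1), 1, 0 => x; rewrite /bary2 /=; field.
- by exists 1, (-1), (-1), 0 => x; rewrite /bary2 /=; field.
- by exists (-1), 2, 1, 0 => x; rewrite /bary2 /=; field.
- by exists 0, 0, 1, 0 => x; rewrite /bary2 /=; field.
- by exists 1, (-1), (-2), 0 => x; rewrite /bary2 /=; field.
- by exists 0, 1, 0, 0 => x; rewrite /bary2 /=; field.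
Qed.

Lemma poly2_orthogonal (f1 f2 : 'I_3) k (f q : R * R -> R) :
  (f1, f2) \in edges ->
  (forall a b, (a + b + 2 <= k)%N ->
    @simplex2_integral R
      (fun x => f x * (bary2 f1 x ^+ a * bary2 f2 x ^+ b)) 0) ->
  poly2 (k%:Z - 2) q -> @simplex2_integral R (fun x => f x * q x) 0.
Proof.
move=> F12 fD [N [c qE]]; have [ax ay] := affine_edges F12.
have [_ DZ] := simplex2_integral_linear R.
have D0 : @simplex2_integral R (fun=> 0) 0.
  have := DZ 0 _ _ (simplex2_integral_mono R 0 0 0); rewrite mul0r.
  by under eq_fun do rewrite mul0r.
have mono a b : (a + b + 2 <= k)%N ->
    @simplex2_integral R (fun x => f x * (x.1 ^+ a * x.2 ^+ b)) 0.
  move=> abk.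
  (* The truncated [k - 2] is exact, since [abk] forces [2 <= k]. *)
  have H a' b' c' : (a' + b' + c' <= k - 2)%N ->
      @simplex2_integral R (fun x => f x *
      (bary2 f1 x ^+ a' * bary2 f2 x ^+ b' * bary2 f1 x ^+ c')) 0.
    move=> abc; have := fD (a' + c')%N b'.
    under [X in simplex2_integral X _]eq_fun => x.
      have -> : bary2 f1 x ^+ (a' + c') * bary2 f2 x ^+ b' =
        bary2 f1 x ^+ a' * bary2 f2 x ^+ b' * bary2 f1 x ^+ c'.
        by rewrite exprD; ring.
      over.
    by apply; lia.
  have := affine3_orthogonal (simplex2_integral_linear R) H ax ay ax
    (a := a) (b := b) (c := 0).
  by under eq_fun do rewrite expr0 mulr1; apply; lia.
under eq_fun => x.
  rewrite qE mulr_sumr; under eq_bigr => a _ do rewrite mulr_sumr.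
  over.
apply: linear_rel_sum => // [|a _]; first exact: simplex2_integral_linear.
apply: linear_rel_sum => // [|b abk]; first exact: simplex2_integral_linear.
under eq_fun => x do rewrite -mulrA mulrCA.
by have := DZ (c a b) _ _ (mono a b _); rewrite mulr0; apply; lia.
Qed.

Lemma inner2_eq0 (f1 f2 : 'I_3) k (f g : R * R -> R)
    (c : R * R * (R * R)) q1 q2 :
  (f1, f2) \in edges ->
  (forall a b, (a + b + 2 <= k)%N ->
    @simplex2_integral R
      (fun x => f x * (bary2 f1 x ^+ a * bary2 f2 x ^+ b)) 0) ->
  (forall a b, (a + b + 2 <= k)%N ->
    @simplex2_integral R
      (fun x => g x * (bary2 f1 x ^+ a * bary2 f2 x ^+ b)) 0) ->
  poly2 (k%:Z - 2) q1 -> poly2 (k%:Z - 2) q2 ->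
  inner2 (fun x => (c.1.1 * f x + c.1.2 * g x, c.2.1 * f x + c.2.2 * g x))
    (fun x => (q1 x, q2 x)) = 0%E.
Proof.
move=> F12 f0 g0 p1 p2; have [DD DZ] := simplex2_integral_linear R.
have D0 a b q : poly2 (k%:Z - 2) q ->
    @simplex2_integral R (fun x => a * (f x * q x) + b * (g x * q x)) 0.
  move=> pq.
  have Df := poly2_orthogonal F12 f0 pq; have Dg := poly2_orthogonal F12 g0 pq.
  by have := DD _ _ _ _ (DZ a _ _ Df) (DZ b _ _ Dg); rewrite !mulr0 addr0.
have [_] := DD _ _ _ _ (D0 c.1.1 c.1.2 _ p1) (D0 c.2.1 c.2.2 _ p2).
rewrite addr0 => I0; rewrite -[RHS]I0; apply: eq_integral => x _ /=.
by congr (_%:E); ring.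
Qed.

(** By the chain rule the curl is a constant matrix applied to the two derivatives of
    [homog k.+1 p]. These are [homog k] of a Legendre polynomial and of [hderiv k p], both
    orthogonal to weights of degree at most [k - 2]. *)
Lemma phi2_orthogonal (f1 f2 : 'I_3) k (q1 q2 : R * R -> R) :
  (f1, f2) \in edges -> poly2 (k%:Z - 2) q1 -> poly2 (k%:Z - 2) q2 ->
  inner2 (phi2 f1 f2 k) (fun x => (q1 x, q2 x)) = 0%E.
Proof.
move=> F12 p1 p2; have dD := dirichlet2_edges R F12.
have [s1 [s2 [sx sy]]] := bary2_partial R f1.
have [t1 [t2 [tx ty]]] := bary2_partial R f2.
have lx x : (x.1, x.2) = x :> R * R by case: x.
set p := intjacobi R 0 k.+1.
have hx := has_partial_homog lx k p (has_partialB tx sx) (has_partialD tx sx).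
have hy := has_partial_homog lx k p (has_partialB ty sy) (has_partialD ty sy).
rewrite /phi2 -/p (curl2_has_partial hx hy).
pose A x : R := bary2 f2 x - bary2 f1 x.
pose B x : R := bary2 f2 x + bary2 f1 x.
have := @inner2_eq0 f1 f2 k (fun x => homog k p^`() (A x) (B x))
  (fun x => homog k (hderiv k p) (A x) (B x))
  (t2 - s2, t2 + s2, (- (t1 - s1), - (t1 + s1))) q1 q2 F12 _ _ p1 p2.
under [X in inner2 X _]eq_fun do rewrite !mulNr -opprD.
apply=> a b abk; apply: duffy2_eq0 => //; try exact: simplex2_integral_linear.
- by rewrite deriv_intjacobi size_jacobi.
- by rewrite deriv_intjacobi jacobi_orthogonal//; lia.
- by rewrite size_hderiv// size_intjacobi.
- by rewrite hderiv_orthogonal//; lia.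
Qed.

End TwoDimensional.

(** * Face functions on the tetrahedron *)

Section ThreeDimensional.
Variable R : realType.
Local Notation vec := (R * R * R)%type.

Lemma affine_faces (f1 f2 f3 : 'I_4) : (f1, f2, f3) \in faces ->
  let affine := affine3 (@bary3 R f1) (@bary3 R f2) (@bary3 R f3) in
  [/\ affine (fun x => x.1.1), affine (fun x => x.1.2) & affine (fun x => x.2)].
Proof.
rewrite !inE => /or4P[] /eqP[-> -> ->]; split.
- by exists 0, (-1), 1, 0 => x; rewrite /bary3 /=; field.
- by exists 0, 0, 0, 1 => x; rewrite /bary3 /=; field.
- by exists 1, (-1), (-1), (-1) => x; rewrite /bary3 /=; field.
- by exists 1, (-2), (-1), (-1) => x; rewrite /bary3 /=; field.
- by exists 0, 0, 1, 0 => x; rewrite /bary3 /=; field.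
- by exists 0, 0, 0, 1 => x; rewrite /bary3 /=; field.
- by exists 0, (-1), 1, 0 => x; rewrite /bary3 /=; field.
- by exists 1, (-1), (-1), (-1) => x; rewrite /bary3 /=; field.
- by exists 0, 0, 0, 1 => x; rewrite /bary3 /=; field.
- by exists (-1), 2, 1, 1 => x; rewrite /bary3 /=; field.
- by exists 0, 0, 1, 0 => x; rewrite /bary3 /=; field.
- by exists 0, 0, 0, 1 => x; rewrite /bary3 /=; field.
Qed.

Definition orthogonal3 (f1 f2 f3 : 'I_4) k (f : vec -> R) :=
  forall a b c, (a + b + c + 2 <= k)%N -> @simplex3_integral R (fun x =>
    f x * (bary3 f1 x ^+ a * bary3 f2 x ^+ b * bary3 f3 x ^+ c)) 0.

Lemma poly3_orthogonal (f1 f2 f3 : 'I_4) k (f q : vec -> R) :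
  (f1, f2, f3) \in faces -> orthogonal3 f1 f2 f3 k f ->
  poly3 (k%:Z - 2) q -> @simplex3_integral R (fun x => f x * q x) 0.
Proof.
move=> F fD [N [d qE]]; have [ax ay az] := affine_faces F.
have [_ DZ] := simplex3_integral_linear R.
have D0 : @simplex3_integral R (fun=> 0) 0.
  have := DZ 0 _ _ (simplex3_integral_mono R 0 0 0 0); rewrite mul0r.
  by under eq_fun do rewrite mul0r.
have mono a b c : (a + b + c + 2 <= k)%N ->
    @simplex3_integral R
      (fun x => f x * (x.1.1 ^+ a * x.1.2 ^+ b * x.2 ^+ c)) 0.
  move=> abk; apply: (affine3_orthogonal (simplex3_integral_linear R)
    (N := (k - 2)%N) _ ax ay az) => [a' b' c' abc|]; last by lia.
  by apply: fD; lia.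
under eq_fun => x.
  rewrite qE mulr_sumr; under eq_bigr => a _.
    rewrite mulr_sumr; under eq_bigr => b _ do rewrite mulr_sumr.
    over.
  over.
apply: linear_rel_sum => // [|a _]; first exact: simplex3_integral_linear.
apply: linear_rel_sum => // [|b _]; first exact: simplex3_integral_linear.
apply: linear_rel_sum => // [|c abk]; first exact: simplex3_integral_linear.
under eq_fun => x do rewrite -!mulrA mulrCA [_ ^+ a * _]mulrA.
by have := DZ (d a b c) _ _ (mono a b c _); rewrite mulr0; apply; lia.
Qed.

Lemma inner3_eq0 (f1 f2 f3 : 'I_4) k (f g h : vec -> R) (u v w : vec) q1 q2 q3 :
  (f1, f2, f3) \in faces -> orthogonal3 f1 f2 f3 k f ->
  orthogonal3 f1 f2 f3 k g -> orthogonal3 f1 f2 f3 k h ->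
  poly3 (k%:Z - 2) q1 -> poly3 (k%:Z - 2) q2 -> poly3 (k%:Z - 2) q3 ->
  inner3 (fun x => f x *: u + g x *: v + h x *: w)
    (fun x => (q1 x, q2 x, q3 x)) = 0%E.
Proof.
move=> F f0 g0 h0 p1 p2 p3; have [DD DZ] := simplex3_integral_linear R.
have D0 a b c q : poly3 (k%:Z - 2) q ->
    @simplex3_integral R
      (fun x => a * (f x * q x) + b * (g x * q x) + c * (h x * q x)) 0.
  move=> pq; have Df := poly3_orthogonal F f0 pq.
  have Dg := poly3_orthogonal F g0 pq; have Dh := poly3_orthogonal F h0 pq.
  have := DD _ _ _ _ (DD _ _ _ _ (DZ a _ _ Df) (DZ b _ _ Dg)) (DZ c _ _ Dh).
  by rewrite !mulr0 !addr0.
have [_] := DD _ _ _ _ (DD _ _ _ _ (D0 u.1.1 v.1.1 w.1.1 _ p1)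
  (D0 u.1.2 v.1.2 w.1.2 _ p2)) (D0 u.2 v.2 w.2 _ p3).
rewrite !addr0 => I0; rewrite -[RHS]I0; apply: eq_integral => x _.
case: u v w {D0 I0} => [[? ?] ?] [[? ?] ?] [[? ?] ?].
by rewrite !scale_triple !add_triple /=; congr (_%:E); ring.
Qed.

Lemma bary3_gradient (i : 'I_4) : exists g : vec, gradient (bary3 i) g.
Proof. by have [a [b [c h]]] := bary3_partial R i; exists (a, b, c). Qed.

Lemma gradientD (f g : vec -> R) (a b : vec) : gradient f a -> gradient g b ->
  gradient (fun x => f x + g x) (a + b).
Proof.
case: a b => [[? ?] ?] [[? ?] ?] [? ? ?] [? ? ?].
by split; exact: has_partialD.
Qed.

Lemma gradientB (f g : vec -> R) (a b : vec) : gradient f a -> gradient g b ->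
  gradient (fun x => f x - g x) (a - b).
Proof.
case: a b => [[? ?] ?] [[? ?] ?] [? ? ?] [? ? ?].
by split; exact: has_partialB.
Qed.

Lemma size_radial n (p : {poly R}) :
  (size p <= n.+2)%N -> (size (radial n p) <= n.+1)%N.
Proof.
move=> sp; apply: leq_trans (size_polyD _ _) _.
rewrite geq_max size_hderiv//=; have [->|p0] := eqVneq p 0.
  by rewrite deriv0 size_poly0.
by rewrite -ltnS; exact: leq_trans (lt_size_deriv p0) sp.
Qed.

Lemma size_axial n (p : {poly R}) :
  (size p <= n.+2)%N -> (size (axial n p) <= n.+1)%N.
Proof.
move=> sp; apply: leq_trans (size_polyD _ _) _.
rewrite size_polyN geq_max size_hderiv//=; have [->|p0] := eqVneq p 0.
  by rewrite deriv0 size_poly0.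
by rewrite -ltnS; exact: leq_trans (lt_size_deriv p0) sp.
Qed.

Lemma homog_radial n (p : {poly R}) x y :
  homog n (radial n p) x y = homog n (hderiv n p) x y + homog n p^`() x y.
Proof. exact: homogD. Qed.

Lemma homog_axial n (p : {poly R}) x y :
  homog n (axial n p) x y = homog n (hderiv n p) x y - homog n p^`() x y.
Proof. exact: homogB. Qed.

Section Face.
Variables (f1 f2 f3 : 'I_4).
Let s := @bary3 R f1.
Let t := @bary3 R f2.
Let r := @bary3 R f3.
Let A x := t x - s x.
Let B x := t x + s x.
Let C x := r x - B x.
Let W x := r x + B x.

Lemma v3E i j x :
  v3 f1 f2 f3 i j x = homog j (intjacobi R (2 * i - 1) j) (C x) (W x).
Proof. by rewrite /v3 /C /W /B opprD !addrA. Qed.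

Lemma orthogonal3_homog k m n (P Q : {poly R}) : (f1, f2, f3) \in faces ->
  (size P <= m.+1)%N -> (size Q <= n.+1)%N ->
  (forall a b c, (a + b + c + 2 <= k)%N -> pint1 (P * bernstein R a b) = 0 \/
    pint1 (Q * bernstein R (m + a + b).+1 c) = 0) ->
  orthogonal3 f1 f2 f3 k
    (fun x => homog m P (A x) (B x) * homog n Q (C x) (W x)).
Proof.
move=> F sP sQ PQ a b c abc.
by apply: duffy3_eq0; [exact: simplex3_integral_linear|
  exact: dirichlet3_faces|..|exact: PQ].
Qed.

(** The gradients of [C] and [W] are those of [r] minus and plus that of [B], which regroups the
    derivatives into [radial] along the gradient of [r] and [axial] along that of [B]. The fourth
    term carries the cross product of the gradient of [B] with itself. *)
Lemma phi3_curl_gradients i j : exists u v w : vec,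
  let p := intjacobi R 0 i.+2 in
  let q := intjacobi R (2 * i.+2 - 1) j.+1 in
  phi3 f1 f2 f3 i.+1 j = fun x =>
    (homog i.+1 p^`() (A x) (B x) *
       homog j (radial j q) (C x) (W x)) *: u +
    (homog i.+1 p^`() (A x) (B x) *
       homog j (axial j q) (C x) (W x)) *: v +
    (homog i.+1 (hderiv i.+1 p) (A x) (B x) *
       homog j (radial j q) (C x) (W x)) *: w.
Proof.
have [gs hs] := bary3_gradient f1; have [gt ht] := bary3_gradient f2.
have [gr hr] := bary3_gradient f3.
exists (cross gr (gt - gs)), (cross (gt + gs) (gt - gs)), (cross gr (gt + gs)).
move=> p q.
have -> : phi3 f1 f2 f3 i.+1 j = curl3 (fun x => homog j.+1 q (C x) (W x) *:
    grad3 (fun x => homog i.+2 p (A x) (B x)) x).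
  by rewrite /phi3; under eq_fun do rewrite v3E.
have hA := gradientB ht hs; have hB := gradientD ht hs.
rewrite (curl3_grad i j p q hA hB (gradientB hr hB) (gradientD hr hB)).
apply/funext => x; rewrite !homog_radial !homog_axial /C /W /A /B /r /t /s.
move: (homog _ _ _ _) (homog _ _ _ _) (homog _ _ _ _) (homog _ _ _ _).
move=> UA VX VW UB.
case: gs gt gr {hs ht hr hA hB} => [[? ?] ?] [[? ?] ?] [[? ?] ?].
rewrite /cross !scale_triple !add_triple /=.
by congr (_, _, _); ring.
Qed.

Lemma phi3_orthogonal i j (q1 q2 q3 : vec -> R) :
  (f1, f2, f3) \in faces ->
  poly3 ((i.+1 + j)%N%:Z - 2) q1 -> poly3 ((i.+1 + j)%N%:Z - 2) q2 ->
  poly3 ((i.+1 + j)%N%:Z - 2) q3 ->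
  inner3 (phi3 f1 f2 f3 i.+1 j) (fun x => (q1 x, q2 x, q3 x)) = 0%E.
Proof.
move=> F p1 p2 p3; have [u [v [w]]] := phi3_curl_gradients i j; cbv zeta => ->.
have sdp : (size (intjacobi R 0 i.+2)^`() <= i.+2)%N.
  by rewrite deriv_intjacobi size_jacobi.
have shp : (size (hderiv i.+1 (intjacobi R 0 i.+2)) <= i.+2)%N.
  by rewrite size_hderiv// size_intjacobi.
have [sr sa] := (size_radial (size_intjacobi R (2 * i.+2 - 1) j.+1),
  size_axial (size_intjacobi R (2 * i.+2 - 1) j.+1)).
refine (@inner3_eq0 f1 f2 f3 (i.+1 + j) _ _ _ u v w q1 q2 q3 F _ _ _ p1 p2 p3);
  apply: orthogonal3_homog => // a b c abc.
(* The Legendre factor settles [a + b <= i]. Otherwise the weight of the second factor has exponent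
   [(i.+1 + a + b).+1], which reaches the Jacobi index [2 * i.+2 - 1]. *)
- have [ab|ab] := ltnP (a + b) i.+1; [left|right].
    by rewrite deriv_intjacobi jacobi_orthogonal//; lia.
  by apply: radial_orthogonal; lia.
- have [ab|ab] := ltnP (a + b) i.+1; [left|right].
    by rewrite deriv_intjacobi jacobi_orthogonal//; lia.
  by apply: axial_orthogonal; lia.
(* The threshold drops by one, so the exponent may fall one short of the Jacobi index, as
   [radial_orthogonal] permits. *)
- have [ab|ab] := ltnP (a + b + 1) i.+1; [left|right].
    exact: hderiv_orthogonal.
  by apply: radial_orthogonal; lia.
Qed.

(** For [N = t gs - s gt] the curl of [v N] is [cross (grad v) N + v curl N], with [curl N] twice
    [cross gt gs]. The part of [grad v] along [gt + gs] yields [B] times [cross gt gs], the part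
    along [gr] yields [t] times [cross gr gs] plus [s] times [cross gt gr]. *)
Lemma phi3_nedelec n : exists u v w : vec,
  let q := intjacobi R 3 n.+1 in
  phi3 f1 f2 f3 0 n.+1 = fun x =>
    (homog 0 1 (A x) (B x) * homog n.+1 (nedelec_poly n q) (C x) (W x)) *: u +
    (homog 1 (bernstein R 0 1) (A x) (B x) *
       homog n (radial n q) (C x) (W x)) *: v +
    (homog 1 (bernstein R 1 0) (A x) (B x) *
       homog n (radial n q) (C x) (W x)) *: w.
Proof.
have [gs hs] := bary3_gradient f1; have [gt ht] := bary3_gradient f2.
have [gr hr] := bary3_gradient f3.
(* The halves offset the doubling in [nedelec_poly] and the values [2 t], [2 s] of the linear
   Bernstein factors. *)
exists (2^-1 *: cross gt gs), (2^-1 *: cross gr gs), (2^-1 *: cross gt gr) => q.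
pose v x := homog n.+1 q (C x) (W x).
have -> : phi3 f1 f2 f3 0 n.+1 = curl3 (fun x => v x *:
    (gs.1.1 * t x - gt.1.1 * s x, gs.1.2 * t x - gt.1.2 * s x,
     gs.2 * t x - gt.2 * s x)).
  rewrite /phi3; congr curl3; apply/funext => x; rewrite v3E /nedelec3 /grad3.
  case: hs ht => [sx sy sz] [tx ty tz].
  rewrite (d3x_has_partial sx) (d3y_has_partial sy) (d3z_has_partial sz).
  rewrite (d3x_has_partial tx) (d3y_has_partial ty) (d3z_has_partial tz).
  by rewrite !(mulrC _ (t x)) !(mulrC _ (s x)).
have hB := gradientD ht hs.
have [cx cy cz] := gradientB hr hB; have [wx wy wz] := gradientD hr hB.
case: hs ht {hr hB} => [sx sy sz] [tx ty tz].
have lx x : (x.1.1, x.1.2, x.2) = x :> vec by case: x => [[? ?] ?].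
have vx := has_partial_homog lx n q cx wx.
have vy := has_partial_homog lx n q cy wy.
have vz := has_partial_homog lx n q cz wz.
rewrite (@curl3_has_partial _ (fun x => v x *:
    (gs.1.1 * t x - gt.1.1 * s x, gs.1.2 * t x - gt.1.2 * s x,
     gs.2 * t x - gt.2 * s x)) _ _ _ _ _ _
  (has_partialM lx vy (has_partialB (has_partialZ gs.1.1 ty)
     (has_partialZ gt.1.1 sy)))
  (has_partialM lx vz (has_partialB (has_partialZ gs.1.1 tz)
     (has_partialZ gt.1.1 sz)))
  (has_partialM lx vx (has_partialB (has_partialZ gs.1.2 tx)
     (has_partialZ gt.1.2 sx)))
  (has_partialM lx vz (has_partialB (has_partialZ gs.1.2 tz)
     (has_partialZ gt.1.2 sz)))
  (has_partialM lx vx (has_partialB (has_partialZ gs.2 tx)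
     (has_partialZ gt.2 sx)))
  (has_partialM lx vy (has_partialB (has_partialZ gs.2 ty)
     (has_partialZ gt.2 sy)))).
apply/funext => x.
have -> : homog 0 1 (A x) (B x) = 1.
  by rewrite /homog big_ord1 coef1 !expr0 !mulr1.
rewrite (homog_bernstein 0 1) (homog_bernstein 1 0).
(* The factor [1 - X] homogenises to [W - C = 2 B]. *)
have -> : homog n.+1 (nedelec_poly n q) (C x) (W x) =
    2 * B x * homog n (axial n q) (C x) (W x) + 4 * v x.
  rewrite /nedelec_poly mulrBl mul1r homogD homogB homogZ homogMX.
  rewrite [homog _ (axial _ _) _ _]homogS ?size_axial ?size_intjacobi//.
  by rewrite /v /W /C; ring.
rewrite homog_radial homog_axial /v /C /W /B /A /r /t /s.
move: (homog _ _ _ _) (homog _ _ _ _) (homog _ _ _ _) => V0 V1 V2.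
case: gs gt gr {sx sy sz tx ty tz cx cy cz wx wy wz vx vy vz}
  => [[? ?] ?] [[? ?] ?] [[? ?] ?].
rewrite /cross !scale_triple !add_triple /=.
by congr (_, _, _); rewrite /GRing.scale /=; field.
Qed.

Lemma phi3_nedelec_orthogonal n (q1 q2 q3 : vec -> R) :
  (f1, f2, f3) \in faces ->
  poly3 (n.+1%:Z - 2) q1 -> poly3 (n.+1%:Z - 2) q2 -> poly3 (n.+1%:Z - 2) q3 ->
  inner3 (phi3 f1 f2 f3 0 n.+1) (fun x => (q1 x, q2 x, q3 x)) = 0%E.
Proof.
move=> F p1 p2 p3; have [u [v [w]]] := phi3_nedelec n; cbv zeta => ->.
have sq := size_intjacobi R 3 n.+1.
refine (@inner3_eq0 f1 f2 f3 n.+1 _ _ _ u v w q1 q2 q3 F _ _ _ p1 p2 p3);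
  apply: orthogonal3_homog;
  rewrite ?size_poly1 ?size_bernstein ?size_radial//.
- apply: leq_trans (size_polyD _ _) _; rewrite geq_max.
  rewrite (leq_trans (size_scale_leq _ _)) ?andbT//.
  apply: leq_trans (size_polyMleq _ _) _.
  have := size_axial sq; have := size_bernstein R 1 0.
  by rewrite /bernstein mulr1 expr1; lia.
(* The second factor always vanishes: its weight has exponent [a + b + 1] here and [a + b + 2] in
   the radial cases, enough for the Jacobi index 3. *)
- by move=> a b c abc; right; apply: nedelec_orthogonal; lia.
- by move=> a b c abc; right; apply: radial_orthogonal; lia.
- by move=> a b c abc; right; apply: radial_orthogonal; lia.
Qed.

End Face.
End ThreeDimensional.

Theorem lemma3p2 (R : realType) (k : nat) (hk : (1 <= k)%N) :
  (forall f1 f2 : 'I_3, (f1, f2) \in edges ->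
   forall q1 q2 : R * R -> R,
     poly2 (k%:Z - 2) q1 -> poly2 (k%:Z - 2) q2 ->
     inner2 (phi2 f1 f2 k) (fun x => (q1 x, q2 x)) = 0%E)
  /\
  (forall f1 f2 f3 : 'I_4, (f1, f2, f3) \in faces ->
   forall i j : nat, (i + j)%N = k ->
   forall q1 q2 q3 : R * R * R -> R,
     poly3 (k%:Z - 2) q1 -> poly3 (k%:Z - 2) q2 -> poly3 (k%:Z - 2) q3 ->
     inner3 (phi3 f1 f2 f3 i j) (fun x => (q1 x, q2 x, q3 x)) = 0%E).
Proof.
split=> [f1 f2 F q1 q2|f1 f2 f3 F i j ij q1 q2 q3]; first exact: phi2_orthogonal.
move: hk; rewrite -{}ij; case: i => [|i] hk p1 p2 p3; last first.
  exact: phi3_orthogonal F p1 p2 p3.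
(* The pair [i = j = 0] is excluded by [1 <= k]. *)
case: j hk p1 p2 p3 => [|n] // _ p1 p2 p3.
exact: (phi3_nedelec_orthogonal F p1 p2 p3).
Qed.
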